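(* Let $(M,\Lambda,E,\omega)$ be a twisted Jacobi manifold and $M_0$ a submanifold of $M$, of codimension $1$, transverse to $E$. Let $\varpi:U\to M_0$ be the projection onto $M_0$ of a tubular neighbourhood $U$ of $M_0$ in $M$ along the integral curves of $E$, i.e. for any $x_0\in M_0$, $\varpi^{-1}(x_0)$ is a connected arc of the integral curve of $E$ through $x_0$. Let $\eta$ be the 1-form along $M_0$ (section of $T^*M|_{M_0}$) such that $i(E)\eta=1$ and $i(X)\eta=0$ for every vector field $X$ on $M$ tangent to $M_0$, and set $Z_0=\Lambda^\#(\eta)$. If $\omega=\varpi^*\omega_0$ (on $U$), where $\omega_0$ is a 2-form on $M_0$, then there exists on $M_0$ a unique exact twisted Poisson structure $(\Lambda_0,d\omega_0)$ such that $\varpi:U\to M_0$ is a twisted Jacobi map and $$\mathcal{L}_{Z_0}\Lambda_0=-\Lambda_0-\Lambda_0^\#\big(d\omega_0(Z_0,\cdot,\cdot)-\omega_0\big).$$ Moreover, $(\Lambda_0,d\omega_0,Z_0)$ is homogeneous if and only if $\omega_0=d\omega_0(Z_0,\cdot,\cdot)$.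
   Context: Bivector conventions: for a bivector field $\Lambda$ on a manifold $M$, $\Lambda^\#:T^*M\to TM$ is defined by $\langle\eta,\Lambda^\#(\zeta)\rangle=\Lambda(\zeta,\eta)$. For a $k$-form $\zeta$, $\Lambda^\#(\zeta)$ is the $k$-vector field $\Lambda^\#(\zeta)(\alpha_1,\dots,\alpha_k)=(-1)^k\zeta(\Lambda^\#\alpha_1,\dots,\Lambda^\#\alpha_k)$. For a 3-form $\zeta$, $(\Lambda^\#\otimes1)(\zeta)(E)$ is the bivector field $(\alpha_1,\alpha_2)\mapsto-\zeta(\Lambda^\#\alpha_1,\Lambda^\#\alpha_2,E)$; for a 2-form $\omega$, $(\Lambda^\#\otimes1)(\omega)(E)$ is the vector field $\alpha_1\mapsto\omega(\Lambda^\#\alpha_1,E)$. Twisted Jacobi manifold: a manifold $M$ with a bivector field $\Lambda$, a vector field $E$ and a 2-form $\omega$ such that $$\tfrac12[\Lambda,\Lambda]+E\wedge\Lambda=\Lambda^\#(d\omega)+\Lambda^\#(\omega)\wedge E,\qquad [E,\Lambda]=(\Lambda^\#\otimes1)(d\omega)(E)-((\Lambda^\#\otimes1)(\omega)(E))\wedge E,$$ where $[\cdot,\cdot]$ is the Schouten bracket with sign convention $\frac12[\Lambda,\Lambda](df,dg,dh)=\Lambda(df,d(\Lambda(dg,dh)))+$ cyclic permutations, and $[E,\Lambda]=\mathcal{L}_E\Lambda$. Exact twisted Poisson structure $(\Lambda,d\omega)$: a bivector field $\Lambda$ and a 2-form $\omega$ with $\frac12[\Lambda,\Lambda]=\Lambda^\#(d\omega)$;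 it is regarded as the twisted Jacobi structure $(\Lambda,0,\omega)$. It is homogeneous with respect to a vector field $Z$ (one says $(\Lambda,d\omega,Z)$ is homogeneous) if $\mathcal{L}_Z\Lambda=-\Lambda$ and $\omega=i(Z)d\omega$. A smooth map $\psi:(M_1,\Lambda_1,E_1,\omega_1)\to(M_2,\Lambda_2,E_2,\omega_2)$ between twisted Jacobi manifolds is a twisted Jacobi map if $\Lambda_2=\psi_*\Lambda_1$, $E_2=\psi_*E_1$ and $\omega_1=\psi^*\omega_2$. *)

(* Defs.v *)
From HB Require Import structures.
From mathcomp Require Import all_boot all_order all_algebra.
From mathcomp Require Import all_classical all_reals all_analysis.

Set Implicit Arguments.
Unset Strict Implicit.
Unset Printing Implicit Defensive.

Import Order.TTheory GRing.Theory Num.Theory.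
Import numFieldNormedType.Exports.
Local Open Scope classical_set_scope.
Local Open Scope ring_scope.

(** * Smooth manifolds *)

(* Meant for open [A] and finite-dimensional [V]. *)
Fixpoint Ck_on (R : realType) (V W : normedModType R) (k : nat)
    (A : set V) (f : V -> W) : Prop :=
  match k with
  | 0 => forall x, A x -> {for x, continuous f}
  | k'.+1 => (forall x, A x -> differentiable f x) /\
             forall v, Ck_on k' A ('D_v f)
  end.

Definition smooth_on (R : realType) (V W : normedModType R)
    (A : set V) (f : V -> W) : Prop := forall k, Ck_on k A f.

(* The atlas is indexed by the points: [chart p] is a chart around [p], with
   domain [chart_dom p] and inverse [param p].  Every smooth structure is
   presented in this way, by choosing a chart around each point. *)
Record manifold (R : realType) (n : nat) := Manifold {
  points :> topologicalType;
  chart_dom : points -> set points;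
  chart : points -> points -> 'rV[R]_n;
  param : points -> 'rV[R]_n -> points;
  manifold_hausdorff : hausdorff_space points;
  manifold_second_countable : @second_countable points;
  chart_dom_open : forall p, open (chart_dom p);
  chart_dom_center : forall p, chart_dom p p;
  chart_codom_open : forall p, open (chart p @` chart_dom p);
  chartK : forall p q, chart_dom p q -> param p (chart p q) = q;
  chart_continuous : forall p q, chart_dom p q -> {for q, continuous (chart p)};
  param_continuous : forall p y, (chart p @` chart_dom p) y ->
    {for y, continuous (param p)};
  chart_compatible : forall p q,
    smooth_on (chart p @` (chart_dom p `&` chart_dom q)) (chart q \o param p)
}.

Definition smooth_fun_on (R : realType) (n : nat) (M : manifold R n)
    (A : set M) (f : M -> R) : Prop :=
  forall p, smooth_on (chart p @` (A `&` chart_dom p)) (f \o param p).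

Definition smooth_fun_near (R : realType) (n : nat) (M : manifold R n)
    (p : M) (f : M -> R) : Prop :=
  exists A : set M, [/\ open A, A p & smooth_fun_on A f].

Definition smooth_map_on (R : realType) (m n : nat) (M : manifold R m)
    (N : manifold R n) (A : set M) (F : M -> N) : Prop :=
  (forall p, A p -> {for p, continuous F}) /\
  forall p q, smooth_on (chart p @` (A `&` chart_dom p `&` F @^-1` chart_dom q))
                        (chart q \o F \o param p).

(** * Tensors

  A tangent vector at [p] is the row ['rV[R]_n] of its components in the chart
  [chart p] centred at [p] itself, and a covector at [p] is the column
  ['cV[R]_n] of its components in the dual basis.  A bivector [L] and a 2-form
  [W] at [p] are skew-symmetric matrices in these bases. *)

Definition pairing (R : realType) (n : nat) (a : 'cV[R]_n) (X : 'rV[R]_n) : R :=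
  (X *m a) 0 0.

Definition bivec (R : realType) (n : nat) (L : 'M[R]_n) (a b : 'cV[R]_n) : R :=
  (a^T *m L *m b) 0 0.

Definition form2 (R : realType) (n : nat) (W : 'M[R]_n) (X Y : 'rV[R]_n) : R :=
  (X *m W *m Y^T) 0 0.

Definition differential (R : realType) (n : nat) (M : manifold R n)
    (f : M -> R) (p : M) : 'cV[R]_n :=
  \col_i 'd (f \o param p) (chart p p) (delta_mx 0 i).

(* The tangent map of [F] at [p] is [X |-> X *m tangent_mx F p]; its transpose
   on covectors is [a |-> tangent_mx F p *m a]. *)
Definition tangent_mx (R : realType) (m n : nat) (M : manifold R m)
    (N : manifold R n) (F : M -> N) (p : M) : 'M[R]_(m, n) :=
  jacobian (chart (F p) \o F \o param p) (chart p p).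

(* Jacobian at [r] of the change of charts from [chart p] to [chart q]. *)
Definition transition_mx (R : realType) (n : nat) (M : manifold R n)
    (p q r : M) : 'M[R]_n :=
  jacobian (chart q \o param p) (chart p r).

(* Components at [q], in the chart [chart p], of tensor fields. *)
Definition vector_in_chart (R : realType) (n : nat) (M : manifold R n)
    (X : M -> 'rV[R]_n) (p q : M) : 'rV[R]_n :=
  X q *m transition_mx q p q.

Definition bivector_in_chart (R : realType) (n : nat) (M : manifold R n)
    (L : M -> 'M[R]_n) (p q : M) : 'M[R]_n :=
  (transition_mx q p q)^T *m L q *m transition_mx q p q.

Definition form2_in_chart (R : realType) (n : nat) (M : manifold R n)
    (W : M -> 'M[R]_n) (p q : M) : 'M[R]_n :=
  transition_mx p q q *m W q *m (transition_mx p q q)^T.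

Definition vector_field (R : realType) (n : nat) (M : manifold R n)
    (X : M -> 'rV[R]_n) : Prop :=
  forall p, smooth_on (chart p @` chart_dom p)
                      (fun y => vector_in_chart X p (param p y)).

Definition bivector_field (R : realType) (n : nat) (M : manifold R n)
    (L : M -> 'M[R]_n) : Prop :=
  (forall p, (L p)^T = - L p) /\
  forall p, smooth_on (chart p @` chart_dom p)
                      (fun y => bivector_in_chart L p (param p y)).

Definition form2_field (R : realType) (n : nat) (M : manifold R n)
    (W : M -> 'M[R]_n) : Prop :=
  (forall p, (W p)^T = - W p) /\
  forall p, smooth_on (chart p @` chart_dom p)
                      (fun y => form2_in_chart W p (param p y)).

(* Koszul's formula for [dW] on the vector fields with constant components
   [X], [Y], [Z] in the chart centred at [p]; their brackets vanish. *)
Definition ext_d (R : realType) (n : nat) (M : manifold R n)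
    (W : M -> 'M[R]_n) (p : M) (X Y Z : 'rV[R]_n) : R :=
  let W' y := form2_in_chart W p (param p y) in
  'D_X (fun y => form2 (W' y) Y Z) (chart p p) +
  'D_Y (fun y => form2 (W' y) Z X) (chart p p) +
  'D_Z (fun y => form2 (W' y) X Y) (chart p p).

(** * Operations attached to a bivector field *)

(* <b, sharp L a> = bivec L a b *)
Definition sharp (R : realType) (n : nat) (L : 'M[R]_n) (a : 'cV[R]_n) :
    'rV[R]_n := a^T *m L.

Definition sharp2 (R : realType) (n : nat) (L : 'M[R]_n)
    (w : 'rV[R]_n -> 'rV[R]_n -> R) (a b : 'cV[R]_n) : R :=
  w (sharp L a) (sharp L b).

Definition sharp3 (R : realType) (n : nat) (L : 'M[R]_n)
    (w : 'rV[R]_n -> 'rV[R]_n -> 'rV[R]_n -> R) (a b c : 'cV[R]_n) : R :=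
  - w (sharp L a) (sharp L b) (sharp L c).

Definition sharp_id2 (R : realType) (n : nat) (L : 'M[R]_n)
    (w : 'rV[R]_n -> 'rV[R]_n -> R) (E : 'rV[R]_n) (a : 'cV[R]_n) : R :=
  w (sharp L a) E.

Definition sharp_id3 (R : realType) (n : nat) (L : 'M[R]_n)
    (w : 'rV[R]_n -> 'rV[R]_n -> 'rV[R]_n -> R) (E : 'rV[R]_n)
    (a b : 'cV[R]_n) : R :=
  - w (sharp L a) (sharp L b) E.

(* Wedge products of multivectors, seen as functions of covectors; a vector
   and a bivector commute. *)
Definition wedge11 (R : realType) (n : nat) (X Y : 'cV[R]_n -> R)
    (a b : 'cV[R]_n) : R := X a * Y b - X b * Y a.

Definition wedge12 (R : realType) (n : nat) (X : 'cV[R]_n -> R)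
    (B : 'cV[R]_n -> 'cV[R]_n -> R) (a b c : 'cV[R]_n) : R :=
  X a * B b c + X b * B c a + X c * B a b.

Definition lie_fun (R : realType) (n : nat) (M : manifold R n)
    (X : M -> 'rV[R]_n) (f : M -> R) (p : M) : R :=
  pairing (differential f p) (X p).

Definition bracket (R : realType) (n : nat) (M : manifold R n)
    (L : M -> 'M[R]_n) (f g : M -> R) (p : M) : R :=
  bivec (L p) (differential f p) (differential g p).

(* (1/2)[L, L](df, dg, dh) *)
Definition half_schouten (R : realType) (n : nat) (M : manifold R n)
    (L : M -> 'M[R]_n) (f g h : M -> R) (p : M) : R :=
  bracket L f (bracket L g h) p + bracket L g (bracket L h f) p +
  bracket L h (bracket L f g) p.

(* (Lie derivative of L along X)(df, dg), by the Leibniz rule and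
   the commutation of the Lie derivative with d on functions *)
Definition lie_bivector (R : realType) (n : nat) (M : manifold R n)
    (X : M -> 'rV[R]_n) (L : M -> 'M[R]_n) (f g : M -> R) (p : M) : R :=
  lie_fun X (bracket L f g) p - bracket L (lie_fun X f) g p -
  bracket L f (lie_fun X g) p.

(** * Twisted Jacobi and twisted Poisson structures

  Identities between multivector fields are tested on differentials of
  functions defined and smooth near the point, which span the cotangent
  space. *)

Definition twisted_jacobi (R : realType) (n : nat) (M : manifold R n)
    (L : M -> 'M[R]_n) (E : M -> 'rV[R]_n) (W : M -> 'M[R]_n) : Prop :=
  [/\ bivector_field L, vector_field E, form2_field W,
      forall (p : M) (f g h : M -> R), smooth_fun_near p f ->
        smooth_fun_near p g -> smooth_fun_near p h ->
        let a := differential f p in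
        let b := differential g p in
        let c := differential h p in
        half_schouten L f g h p + wedge12 (fun t => pairing t (E p)) (bivec (L p)) a b c =
        sharp3 (L p) (ext_d W p) a b c +
        wedge12 (fun t => pairing t (E p)) (sharp2 (L p) (form2 (W p))) a b c
    & forall (p : M) (f g : M -> R), smooth_fun_near p f ->
        smooth_fun_near p g ->
        let a := differential f p in
        let b := differential g p in
        lie_bivector E L f g p =
        sharp_id3 (L p) (ext_d W p) (E p) a b -
        wedge11 (sharp_id2 (L p) (form2 (W p)) (E p)) (fun t => pairing t (E p)) a b].

Definition exact_twisted_poisson (R : realType) (n : nat) (M : manifold R n)
    (L : M -> 'M[R]_n) (W : M -> 'M[R]_n) : Prop :=
  [/\ bivector_field L, form2_field W
    & forall (p : M) (f g h : M -> R), smooth_fun_near p f ->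
        smooth_fun_near p g -> smooth_fun_near p h ->
        half_schouten L f g h p =
        sharp3 (L p) (ext_d W p)
          (differential f p) (differential g p) (differential h p)].

(* W = i(Z) dW *)
Definition is_contraction_d (R : realType) (n : nat) (M : manifold R n)
    (W : M -> 'M[R]_n) (Z : M -> 'rV[R]_n) : Prop :=
  forall p X Y, form2 (W p) X Y = ext_d W p (Z p) X Y.

Definition homogeneous (R : realType) (n : nat) (M : manifold R n)
    (L : M -> 'M[R]_n) (W : M -> 'M[R]_n) (Z : M -> 'rV[R]_n) : Prop :=
  (forall (p : M) (f g : M -> R), smooth_fun_near p f -> smooth_fun_near p g ->
     lie_bivector Z L f g p = - bracket L f g p) /\
  is_contraction_d W Z.

Definition is_pullback_on (R : realType) (m n : nat) (M : manifold R m)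
    (N : manifold R n) (A : set M) (F : M -> N)
    (W1 : M -> 'M[R]_m) (W2 : N -> 'M[R]_n) : Prop :=
  forall p, A p -> W1 p = tangent_mx F p *m W2 (F p) *m (tangent_mx F p)^T.

(* Maps from the open submanifold [A] of [M]. *)
Definition twisted_jacobi_map_on (R : realType) (m n : nat) (M : manifold R m)
    (N : manifold R n) (A : set M) (F : M -> N)
    (L1 : M -> 'M[R]_m) (E1 : M -> 'rV[R]_m) (W1 : M -> 'M[R]_m)
    (L2 : N -> 'M[R]_n) (E2 : N -> 'rV[R]_n) (W2 : N -> 'M[R]_n) : Prop :=
  [/\ smooth_map_on A F,
      forall p, A p -> L2 (F p) = (tangent_mx F p)^T *m L1 p *m tangent_mx F p,
      forall p, A p -> E2 (F p) = E1 p *m tangent_mx F p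
    & is_pullback_on A F W1 W2].

(** * Submanifolds and tubular neighbourhoods *)

(* A submanifold of [M] is given as the image of an embedding. *)
Definition embedding (R : realType) (m n : nat) (N : manifold R m)
    (M : manifold R n) (i : N -> M) : Prop :=
  [/\ smooth_map_on setT i,
      forall x, row_free (tangent_mx i x),
      injective i
    & forall A : set N, open A ->
        exists2 B : set M, open B & i @` A = B `&` range i].

Definition transverse (R : realType) (n : nat) (M0 : manifold R n)
    (M : manifold R n.+1) (i : M0 -> M) (E : M -> 'rV[R]_n.+1) : Prop :=
  forall x (v : 'rV[R]_n), E (i x) <> v *m tangent_mx i x.

Definition integral_curve_on (R : realType) (n : nat) (M : manifold R n)
    (E : M -> 'rV[R]_n) (I : set R) (c : R -> M) : Prop :=
  forall t, I t -> {for t, continuous c} /\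
    is_derive t (1 : R) (chart (c t) \o c) (E (c t)).

(* [r : U -> M0] is the projection of the tubular neighbourhood [U] of the
   submanifold [i : M0 -> M] along the integral curves of [E]; the values of
   [r] outside [U] are irrelevant. *)
Definition tubular_projection (R : realType) (n : nat) (M0 : manifold R n)
    (M : manifold R n.+1) (i : M0 -> M) (E : M -> 'rV[R]_n.+1)
    (U : set M) (r : M -> M0) : Prop :=
  [/\ open U,
      smooth_map_on U r,
      forall p, U p -> row_full (tangent_mx r p)
    & forall x, exists (I : set R) (c : R -> M),
        [/\ [/\ open I, is_interval I & I 0],
            c 0 = i x,
            integral_curve_on E I c,
            {in I &, injective c}
          & c @` I = U `&` r @^-1` [set x]]].

(* [eta] is the 1-form along the hypersurface with [i(E) eta = 1] and with
   [i(X) eta = 0] for [X] tangent to the hypersurface. *)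
Definition conormal_form (R : realType) (n : nat) (M0 : manifold R n)
    (M : manifold R n.+1) (i : M0 -> M) (E : M -> 'rV[R]_n.+1)
    (eta : M0 -> 'cV[R]_n.+1) : Prop :=
  forall x, pairing (eta x) (E (i x)) = 1 /\
    forall v : 'rV[R]_n, pairing (eta x) (v *m tangent_mx i x) = 0.

(* Main.v *)
Require Import Defs.
From HB Require Import structures.
From mathcomp Require Import all_boot all_order all_algebra.
From mathcomp Require Import all_classical all_reals all_analysis.
From mathcomp Require Import ring.
Set Implicit Arguments.
Unset Strict Implicit.
Unset Printing Implicit Defensive.
Import Order.TTheory GRing.Theory Num.Theory.
Import numFieldNormedType.Exports.
Local Open Scope classical_set_scope.
Local Open Scope ring_scope.

(* Since [W] is pulled back along [r], whose fibers are arcs of integral curves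
   of [E], both [W] and [dW] are annihilated by [E].  Hence [[E, L] = 0] on [U],
   the brackets [{f o r, g o r}] are constant along the fibers, and [L] projects
   to a bivector [L0] on [M0]; the first twisted Jacobi identity, tested on
   functions [f o r], is the twisted Poisson identity for [L0].

   The Lie derivative of [L0] along [Z0] comes from the same identity tested on
   [f o r], [g o r] and a function [s] vanishing on the hypersurface with
   [u = E s <> 0], using that at points of the hypersurface
     [{s, F} = u Z0(F)]   and   [{f o r, F} = {f, F}_0 - Z0(f) E(F)];
   every term is a multiple of [u], which cancels.  Taking for [s] a coordinate
   minus its value at the projected point avoids straightening [E]. *)

(** * Functions of class C^k *)

(** The Lie derivative formula lives on the hypersurface, while the nested brackets containing [s]
    differentiate once off it. The transverse derivative that appears is [E{s, f o r}]; it equals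
    [{E s, f o r}] because [[E, L] = 0] and [E(f o r) = 0] near the point, and this brings it back
    to data on [M0] and the second derivative [E(E s)]. All terms containing a derivative of [E s]
    are symmetric in [f] and [g], whereas half the Schouten bracket takes them with opposite signs,
    so the choice of [s] leaves no trace beyond the factor [u]. The quotient [{s, f o r} / u] also
    yields the smoothness of [Z0], [eta] being given only pointwise. Components of tensors refer to
    a chart that changes with the point, so the smoothness of the constructed fields is obtained
    from their action on coordinate functions. That [E] annihilates [dW] rests on the naturality of
    [d] under pullback, hence on the symmetry of second derivatives, which is proved from [Ck_on] by
    the mean value theorem. *)

Section ck_calculus.
Context {R : realType}.
Implicit Types (k : nat).

(** Continuity and differentiability in [Ck_on] are those of the ambient space at each point, not of
    the subspace [A]. This is what allows smoothness to be localized. *)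
Lemma Ck_on_points (V W : normedModType R) k (A : set V) (f : V -> W) :
  Ck_on k A f <-> forall x, A x -> Ck_on k [set x] f.
Proof.
elim: k f => [|k IH] f /=.
  by split=> [h x Ax _ ->|h x Ax]; [exact: h|exact: (h x Ax)].
split=> [[h1 h2] x Ax|h].
  by split=> [_ ->|v]; [exact: h1|exact: (IH _).1 (h2 v) x Ax].
by split=> [x Ax|v]; [exact: (h x Ax).1|apply/IH => x Ax; exact: (h x Ax).2].
Qed.

Lemma Ck_on_subset (V W : normedModType R) k (A B : set V) (f : V -> W) :
  A `<=` B -> Ck_on k B f -> Ck_on k A f.
Proof. by move=> AB /Ck_on_points h; apply/Ck_on_points => x /AB /h. Qed.

Lemma Ck_on_pred (V W : normedModType R) k (A : set V) (f : V -> W) :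
  Ck_on k.+1 A f -> Ck_on k A f.
Proof.
elim: k f => [|k IH] f [h1 h2].
  by move=> x /h1; exact: differentiable_continuous.
by split=> // v; exact: IH.
Qed.

(** The difference [g - f] vanishes near [x], so the zero map is its differential, with zero
    remainder. *)
Lemma near_eq_differentiable (V W : normedModType R) (f g : V -> W) x :
  (\forall y \near x, f y = g y) -> differentiable f x -> differentiable g x.
Proof.
move=> fg df.
have h0 (h : V -> W) (h0 : \forall y \near x, h y = 0) : differentiable h x.
  have c0 : continuous (cst 0 : V -> W) by move=> ?; exact: cvg_cst.
  have hx := nbhs_singleton h0.
  suff E : h \o shift x = cst (h x) + (\0 : V -> W) +o_ 0 id.
    have Ed : 'd h x = \0 :> (V -> W) by apply: diff_unique.
    by apply/diff_locallyP; rewrite Ed.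
  have h1 : \forall y \near (0 : V), h (y + x) = 0.
    by move: h0; rewrite (near_shift 0); apply: filterS => y /=; rewrite subr0.
  apply/eqaddoP => _ /posnumP[e]; near=> y.
  rewrite !fctE /= hx (near h1 y) //.
  by rewrite addr0 subrr normr0 mulr_ge0.
have -> : g = f + (g - f) by rewrite addrC subrK.
apply: differentiableD => //; apply: h0.
by near=> y; rewrite !fctE /= -(near fg y) ?subrr.
Unshelve. all: by end_near. Qed.

Lemma Ck_on_ext (V W : normedModType R) k (A : set V) (f g : V -> W) :
  open A -> (forall x, A x -> f x = g x) -> Ck_on k A f -> Ck_on k A g.
Proof.
move=> oA.
have nA x : A x -> (forall x, A x -> f x = g x) ->
    \forall y \near x, f y = g y.
  by move=> Ax fg; apply: filterS (open_nbhs_nbhs (conj oA Ax)) => y /fg.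
elim: k f g nA => [|k IH] f g nA fg /=.
  move=> h x Ax; have : f @ x --> f x := h x Ax; rewrite (fg _ Ax) => c.
  by apply: cvg_trans c; apply: near_eq_cvg; exact: nA.
move=> [h1 h2]; split=> [x Ax|v].
  by apply: near_eq_differentiable (h1 x Ax); exact: nA.
have E x : A x -> 'D_v f x = 'D_v g x.
  by move=> Ax; apply: near_eq_derive; exact: nA.
apply: IH (h2 v) => // x Ax E'.
by apply: filterS (open_nbhs_nbhs (conj oA Ax)) => y /E'.
Qed.

Lemma Ck_on_cst (V W : normedModType R) k (A : set V) (c : W) :
  Ck_on k A (cst c : V -> W).
Proof.
elim: k c => [|k IH] c /=; first by move=> x _; exact: cvg_cst.
split=> [x _|v]; first exact: differentiable_cst.
have -> : 'D_v (cst c : V -> W) = cst 0 by apply/funext => x; exact: derive_cst.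
exact: IH.
Qed.

Lemma Ck_onD (V W : normedModType R) k (A : set V) (f g : V -> W) :
  open A -> Ck_on k A f -> Ck_on k A g -> Ck_on k A (f \+ g).
Proof.
move=> oA; elim: k f g => [|k IH] f g.
  by move=> cf cg x Ax; apply: cvgD; [exact: cf|exact: cg].
move=> [f1 f2] [g1 g2]; split=> [x Ax|v].
  by apply: differentiableD; [exact: f1|exact: g1].
apply: Ck_on_ext (IH _ _ (f2 v) (g2 v)) => // x Ax /=.
by rewrite deriveD //; apply: diff_derivable; [exact: f1|exact: g1].
Qed.

Lemma Ck_onM (V : normedModType R) k (A : set V) (f g : V -> R) :
  open A -> Ck_on k A f -> Ck_on k A g -> Ck_on k A (f \* g).
Proof.
move=> oA; elim: k f g => [|k IH] f g.
  by move=> cf cg x Ax; apply: cvgM; [exact: cf|exact: cg].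
move=> hf hg; have [f1 f2] := hf; have [g1 g2] := hg.
split=> [x Ax|v].
  by apply: differentiableM; [exact: f1|exact: g1].
have h1 := IH _ _ (Ck_on_pred hf) (g2 v).
have h2 := IH _ _ (Ck_on_pred hg) (f2 v).
apply: Ck_on_ext (Ck_onD oA h1 h2) => // x Ax /=.
by rewrite deriveM //; apply: diff_derivable; [exact: f1|exact: g1].
Qed.

Lemma Ck_onN (V : normedModType R) k (A : set V) (f : V -> R) :
  open A -> Ck_on k A f -> Ck_on k A (\- f).
Proof.
move=> oA hf; have h := Ck_onM oA (@Ck_on_cst V R^o k A (-1)) hf.
apply: Ck_on_ext h => // x _ /=.
by rewrite mulN1r.
Qed.

Lemma Ck_onV (V : normedModType R) k (A : set V) (f : V -> R) :
  open A -> (forall x, A x -> f x != 0) -> Ck_on k A f ->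
  Ck_on k A (fun x => (f x)^-1).
Proof.
move=> oA f0; elim: k => [|k IH].
  by move=> cf x Ax; apply: cvgV; [exact: f0|exact: cf].
move=> hf; have [f1 f2] := hf; split=> [x Ax|v].
  by apply: differentiableV; [exact: f1|exact: f0].
have h := IH (Ck_on_pred hf).
apply: Ck_on_ext (Ck_onN oA (Ck_onM oA (Ck_onM oA h h) (f2 v))) => // x Ax /=.
rewrite deriveV ?f0 //; last exact/diff_derivable/f1.
by rewrite -mulNr -expr2 exprVn.
Qed.

Lemma Ck_on_sum (V W : normedModType R) k (A : set V) I (s : seq I)
    (f : I -> V -> W) :
  open A -> (forall j, Ck_on k A (f j)) ->
  Ck_on k A (fun x => \sum_(j <- s) f j x).
Proof.
move=> oA hf; elim: s => [|j s IH].
  by apply: Ck_on_ext (Ck_on_cst k A 0) => // x _; rewrite big_nil.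
apply: Ck_on_ext (Ck_onD oA (hf j) IH) => // x _; by rewrite /= big_cons.
Qed.

Lemma differentiable_mxP (V : normedModType R) m n (f : V -> 'M[R]_(m, n)) x :
  differentiable f x <-> forall i j, differentiable (fun y => f y i j) x.
Proof.
split=> [df i j|df].
  apply: (@differentiable_comp _ _ _ _ f (fun N : 'M[R]_(m, n) => N i j)) => //.
  exact: differentiable_coord.
have -> : f = \sum_(i < m) \sum_(j < n) (fun y => f y i j *: delta_mx i j).
  apply/funext => y; rewrite fct_sumE [LHS]matrix_sum_delta.
  by apply: eq_bigr => i _; rewrite fct_sumE.
apply: differentiable_sum => i; apply: differentiable_sum => j.
exact: differentiableZl.
Qed.

Lemma Ck_on_mxP (V : normedModType R) k m n (A : set V) (f : V -> 'M[R]_(m, n)) :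
  open A ->
  Ck_on k A f <-> forall i j, Ck_on k A (fun y => f y i j).
Proof.
move=> oA; elim: k f => [|k IH] f.
  split=> [h i j x Ax|h x Ax].
    apply: (@continuous_comp _ _ _ f (fun N : 'M[R]_(m, n) => N i j)).
      exact: h.
    exact: coord_continuous.
  move=> B [P hP PB].
  have : \forall y \near x, forall i j, P i j (f y i j).
    apply: filter_forall => i; apply: filter_forall => j.
    by apply: (h i j x Ax); exact: hP.
  by apply: filterS => y hy; exact: PB.
have E v x i j : differentiable f x -> ('D_v f x) i j = 'D_v (fun y => f y i j) x.
  by move=> df; rewrite derive_mx ?mxE //; exact: diff_derivable.
split=> [[h1 h2] i j|h].
  split=> [x Ax|v]; first exact: (differentiable_mxP _ _).1 (h1 x Ax) i j.
  apply: Ck_on_ext ((IH _).1 (h2 v) i j) => // x /h1; exact: E.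
have h1 x : A x -> differentiable f x.
  by move=> Ax; apply/differentiable_mxP => i j; exact: (h i j).1.
split=> // v; apply/IH => i j.
by apply: Ck_on_ext ((h i j).2 v) => // x /h1 /E ->.
Qed.

Lemma derive_comp_rV (V : normedModType R) n (f : V -> 'rV[R]_n)
    (g : 'rV[R]_n -> R) x v : differentiable f x -> differentiable g (f x) ->
  'D_v (g \o f) x =
  \sum_j 'D_v (fun y => f y 0 j) x * 'D_(delta_mx 0 j) g (f x).
Proof.
move=> df dg; rewrite deriveE; last exact: differentiable_comp.
rewrite diff_comp //= -(deriveE v df); set Y := 'D_v f x.
rewrite [Y]row_sum_delta linear_sum; apply: eq_bigr => j _.
rewrite linearZ /= -deriveE //; congr (_ * _).
by rewrite /Y derive_mx ?mxE //; exact: diff_derivable.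
Qed.

(** The chain rule in coordinates turns the derivative into a sum of products of scalar functions,
    to which the induction hypothesis and [Ck_onM] apply. *)
Lemma Ck_on_comp (V : normedModType R) k n (A : set V) (B : set 'rV[R]_n)
    (f : V -> 'rV[R]_n) (g : 'rV[R]_n -> R) :
  open A -> (forall x, A x -> B (f x)) ->
  Ck_on k A f -> Ck_on k B g -> Ck_on k A (g \o f).
Proof.
move=> oA AB; elim: k g => [|k IH] g.
  by move=> cf cg x Ax; apply: continuous_comp; [exact: cf|apply/cg/AB].
move=> hf [g1 g2]; have [f1 f2] := hf; split=> [x Ax|v].
  by apply: differentiable_comp; [exact: f1|apply/g1/AB].
have fk j := (Ck_on_mxP k.+1 f oA).1 hf 0 j.
have h j := Ck_onM oA ((fk j).2 v) (IH _ (Ck_on_pred hf) (g2 (delta_mx 0 j))).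
apply: Ck_on_ext (Ck_on_sum (index_enum 'I_n) oA h) => // x Ax /=.
by rewrite derive_comp_rV //; [exact: f1|apply/g1/AB].
Qed.

End ck_calculus.

(** * Symmetry of second derivatives *)

Section schwarz.
Context {R : realType} {V : normedModType R}.
Implicit Types (f : V -> R) (x u v : V).

Lemma near_parallelogram x u v (P : set V) :
  (\forall y \near x, P y) ->
  exists2 d : R, 0 < d &
    forall s t : R, `|s| < d -> `|t| < d -> P (x + s *: u + t *: v).
Proof.
move=> /nbhs_ballP[e /= e0 eP]; have D0 : 0 < `|u| + `|v| + 1 :> R.
  by rewrite ltr_wpDl // addr_ge0.
(* The displacement has norm at most the larger of [|s|] and [|t|] times [|u| + |v|]; the added [1]
   keeps the denominator positive when both vectors vanish. *)
exists (e / (`|u| + `|v| + 1)) => [|s t hs ht]; first exact: divr_gt0.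
apply: eP; rewrite -ball_normE /= opprD addrA opprD addrA subrr sub0r.
apply: le_lt_trans (ler_normB _ _) _; rewrite normrN !normrZ.
move: hs ht; rewrite !ltr_pdivlMr // => hs ht.
have hu : 0 <= `|u| by []; have hv : 0 <= `|v| by [].
have [st|ts] := leP `|s| `|t|.
  apply: le_lt_trans ht; rewrite mulrDr mulrDr mulr1.
  by rewrite -addrA lerD ?ler_wpM2r // lerDl.
apply: le_lt_trans hs; rewrite mulrDr mulrDr mulr1.
by rewrite -addrA lerD // (le_trans (ler_wpM2r hv (ltW ts))) // lerDl.
Qed.

Lemma is_derive_line f x u (s : R) : differentiable f (x + s *: u) ->
  is_derive s 1 (fun t : R => f (x + t *: u)) ('D_u f (x + s *: u)).
Proof.
move=> df; have dl : is_diff s (fun t : R => x + t *: u) ( *:%R^~ u).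
  have -> : (fun t : R => x + t *: u) = cst x + ( *:%R^~ u) by [].
  rewrite -[X in is_diff_def _ _ X]add0r; exact: is_diffD.
have dfl : differentiable (f \o (fun t : R => x + t *: u)) s.
  exact: differentiable_comp.
split; first exact/derivable1_diffP.
rewrite deriveE // diff_comp //.
by rewrite /= diff_val scale1r -deriveE.
Qed.

(** Two applications of the mean value theorem: along [u] to the increment [phi] of [f] between two
    parallel lines, then along [v] to ['D_u f]. The left side is symmetric in [u] and [v], so
    exchanging them expresses it by the other mixed derivative. *)
Lemma second_difference f x u v (A : set V) (d : R) :
  Ck_on 2 A f ->
  (forall s t : R, `|s| < d -> `|t| < d -> A (x + s *: u + t *: v)) ->
  forall h, 0 < h < d -> exists s t : R, [/\ `|s| < d, `|t| < d &
    f (x + h *: u + h *: v) - f (x + h *: u) - (f (x + h *: v) - f x) =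
    h ^+ 2 * 'D_v ('D_u f) (x + s *: u + t *: v)].
Proof.
move=> [f1 /(_ u) [f2 _]] hA h /andP[h0 hd].
have hin s : s \in `[0, h]%R -> `|s| <= h /\ `|s| < d.
  by rewrite in_itv /= => /andP[s0 sh]; rewrite ger0_norm // (le_lt_trans sh).
have d0 : `|0 : R| < d by rewrite normr0 (lt_trans h0).
have hh : `|h| < d by rewrite ger0_norm // ltW.
have A0 s : `|s| < d -> A (x + s *: u).
  by move=> sd; have := hA s 0 sd d0; rewrite scale0r addr0.
have Ah s : `|s| < d -> A (x + h *: v + s *: u).
  by move=> sd; have := hA s h sd hh; rewrite addrAC.
pose phi s := f (x + h *: v + s *: u) - f (x + s *: u).
have dphi s : `|s| < d -> is_derive s (1 : R) phi
    ('D_u f (x + h *: v + s *: u) - 'D_u f (x + s *: u)).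
  by move=> sd; apply: is_deriveB; apply: is_derive_line; apply: f1; auto.
have hoo s : s \in `]0, h[%R -> `|s| < d.
  by rewrite in_itv /= => /andP[s0 sh]; rewrite gtr0_norm // (lt_trans sh).
have [|s sI Es] := MVT_segment (ltW h0) (fun s hs => dphi s (hoo s hs)).
  apply: derivable_within_continuous => s /hin[_ sd].
  by have [] := dphi s sd.
have [sh sd] := hin s sI.
pose psi t := 'D_u f (x + s *: u + t *: v).
have dpsi t : `|t| < d -> is_derive t (1 : R) psi
    ('D_v ('D_u f) (x + s *: u + t *: v)).
  by move=> td; apply: is_derive_line; apply: f2; exact: hA.
have [|t tI Et] := MVT_segment (ltW h0) (fun t ht => dpsi t (hoo t ht)).
  apply: derivable_within_continuous => t /hin[_ td].
  by have [] := dpsi t td.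
have [th td] := hin t tI.
exists s, t; split=> //.
move: Es Et; rewrite /phi /psi !scale0r !addr0 !subr0 => Es Et.
by rewrite (addrAC x (h *: u)) Es (addrAC x (h *: v)) Et -mulrA mulrC expr2.
Qed.

(** One second difference equals [h ^+ 2] times either mixed derivative, each taken at its own
    nearby point. Continuity moves both points to [x] at a cost of [e / 2] each. *)
Lemma derive_derive_comm f x u v (A : set V) : open A -> A x -> Ck_on 2 A f ->
  'D_u ('D_v f) x = 'D_v ('D_u f) x.
Proof.
move=> oA Ax f2; apply/eqP; rewrite -subr_eq0 -normr_le0.
apply/ler_addgt0Pr => e e0; rewrite add0r.
have e2 : 0 < e / 2 by rewrite divr_gt0.
have c1 : {for x, continuous ('D_u ('D_v f))} by exact: ((f2.2 v).2 u x Ax).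
have c2 : {for x, continuous ('D_v ('D_u f))} by exact: ((f2.2 u).2 v x Ax).
have nA := open_nbhs_nbhs (conj oA Ax).
have n1 : \forall t \near x, `|'D_u ('D_v f) x - 'D_u ('D_v f) t| < e / 2.
  by move/cvgrPdist_lt: c1; apply.
have n2 : \forall t \near x, `|'D_v ('D_u f) x - 'D_v ('D_u f) t| < e / 2.
  by move/cvgrPdist_lt: c2; apply.
have [d1 d10 H1] := near_parallelogram u v (filterI nA (filterI n1 n2)).
have [d2 d20 H2] := near_parallelogram v u (filterI nA (filterI n1 n2)).
pose h := Num.min d1 d2 / 2.
have m0 : 0 < Num.min d1 d2 by rewrite lt_min d10.
have h0 : 0 < h by rewrite divr_gt0.
have hd : h < Num.min d1 d2 by rewrite gtr_pMr // invf_lt1 // ltr1n.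
have /andP[hd1 hd2] : (h < d1) && (h < d2) by rewrite -lt_min.
have [|s1 [t1 [s1d t1d E1]]] :=
  second_difference f2 (fun s t hs ht => (H1 s t hs ht).1) (h := h).
  by rewrite h0.
have [|s2 [t2 [s2d t2d E2]]] :=
  second_difference f2 (fun s t hs ht => (H2 s t hs ht).1) (h := h).
  by rewrite h0.
have E : 'D_v ('D_u f) (x + s1 *: u + t1 *: v) =
         'D_u ('D_v f) (x + s2 *: v + t2 *: u).
  have h2 : h ^+ 2 != 0 by rewrite expf_neq0 // gt_eqF.
  move: E1 E2; rewrite (addrAC x (h *: v)).
  move: (f _) (f _) (f _) (f _) ('D_v _ _) ('D_u _ _) => a b c e' p q E1 E2.
  by apply: (mulfI h2); rewrite -E1 -E2; ring.
have [_ [_ k1]] := H1 _ _ s1d t1d; have [_ [k2 _]] := H2 _ _ s2d t2d.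
rewrite -(subrKA ('D_u ('D_v f) (x + s2 *: v + t2 *: u))) -{2}E.
rewrite (splitr e); apply: le_trans (ler_normD _ _) _.
by apply: lerD; [exact: ltW k2|rewrite distrC; exact: ltW k1].
Qed.

End schwarz.

(** Smoothness of a germ: the open set may depend on the function, but serves all orders at once.
    Functions can then be combined without tracking a common domain. *)
Definition smooth_near (R : realType) (V W : normedModType R) (x : V)
    (f : V -> W) : Prop :=
  exists2 A : set V, open_nbhs x A & smooth_on A f.

Lemma near_open_nbhs (T : topologicalType) (x : T) (P : T -> Prop) :
  (\forall y \near x, P y) -> exists2 B, open_nbhs x B & forall y, B y -> P y.
Proof. by move=> xP; have : nbhs x [set y | P y] := xP; rewrite nbhsE. Qed.

Section smooth_near.
Context {R : realType}.
Implicit Types V W : normedModType R.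

Lemma smooth_on_near V W (A : set V) (f : V -> W) : open A ->
  smooth_on A f <-> forall x, A x -> smooth_near x f.
Proof.
move=> oA; split=> [h x Ax|h k]; first by exists A.
apply/Ck_on_points => x /h [B [_ Bx] /(_ k) /Ck_on_points]; exact.
Qed.

Lemma smooth_near_near V W (f : V -> W) x : smooth_near x f ->
  \forall y \near x, smooth_near y f.
Proof.
move=> [A oA fA]; apply: filterS (open_nbhs_nbhs oA) => y Ay.
by exists A => //; case: oA.
Qed.

Lemma smooth_near_ext V W (f g : V -> W) x :
  (\forall y \near x, f y = g y) -> smooth_near x f -> smooth_near x g.
Proof.
move=> /near_open_nbhs[B [oB Bx] fg] [A [oA Ax] fA].
exists (A `&` B); first by split; [exact: openI|].
move=> k; apply: (Ck_on_ext _ _ (Ck_on_subset _ (fA k))); first exact: openI.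
  by move=> y [_ /fg].
exact: subIsetl.
Qed.

Lemma smooth_near_differentiable V W (f : V -> W) x :
  smooth_near x f -> differentiable f x.
Proof. by move=> [A [_ Ax] /(_ 1%N) [+ _]]; apply. Qed.

Lemma smooth_near_continuous V W (f : V -> W) x :
  smooth_near x f -> {for x, continuous f}.
Proof.
by move=> /smooth_near_differentiable; exact: differentiable_continuous.
Qed.

Lemma smooth_near_derivable V W (f : V -> W) x v :
  smooth_near x f -> derivable f x v.
Proof. by move=> /smooth_near_differentiable; exact: diff_derivable. Qed.

Lemma smooth_near_derive V W (f : V -> W) x v :
  smooth_near x f -> smooth_near x ('D_v f).
Proof. by move=> [A oA fA]; exists A => // k; exact: (fA k.+1).2. Qed.

Lemma smooth_near_cst V W (c : W) (x : V) : smooth_near x (cst c).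
Proof.
by exists setT; [split=> //; exact: openT|move=> k; exact: Ck_on_cst].
Qed.

Lemma smooth_near_op2 V W1 W2 W3 (x : V) (f : V -> W1) (g : V -> W2)
    (h : V -> W3) :
  (forall k A, open A -> Ck_on k A f -> Ck_on k A g -> Ck_on k A h) ->
  smooth_near x f -> smooth_near x g -> smooth_near x h.
Proof.
move=> H [A [oA Ax] fA] [B [oB Bx] gB].
exists (A `&` B); first by split; [exact: openI|].
move=> k; apply: H; first exact: openI.
  exact: Ck_on_subset (@subIsetl _ _ _) (fA k).
exact: Ck_on_subset (@subIsetr _ _ _) (gB k).
Qed.

Lemma smooth_nearD V W (f g : V -> W) x :
  smooth_near x f -> smooth_near x g -> smooth_near x (f \+ g).
Proof. by apply: smooth_near_op2 => k A; exact: Ck_onD. Qed.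

Lemma smooth_nearM V (f g : V -> R) x :
  smooth_near x f -> smooth_near x g -> smooth_near x (f \* g).
Proof. by apply: smooth_near_op2 => k A; exact: Ck_onM. Qed.

Lemma smooth_nearN V (f : V -> R) x : smooth_near x f -> smooth_near x (\- f).
Proof. by move=> [A [oA Ax] fA]; exists A => // k; exact: Ck_onN. Qed.

Lemma smooth_nearB V (f g : V -> R) x :
  smooth_near x f -> smooth_near x g -> smooth_near x (f \- g).
Proof. by move=> hf hg; exact: smooth_nearD hf (smooth_nearN hg). Qed.

Lemma smooth_nearV V (f : V -> R) x :
  f x != 0 -> smooth_near x f -> smooth_near x (fun y => (f y)^-1).
Proof.
move=> fx hf; have : \forall y \near x, f y != 0.
  have c : f @ x --> f x := smooth_near_continuous hf.
  exact: cvgr_neq0 c fx.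
move=> /near_open_nbhs[B [oB Bx] f0]; have [A [oA Ax] fA] := hf.
exists (A `&` B); first by split; [exact: openI|].
move=> k; apply: Ck_onV; [exact: openI|by move=> y [_ /f0]|].
exact: Ck_on_subset (@subIsetl _ _ _) (fA k).
Qed.

Lemma smooth_near_sum V W I (s : seq I) (f : I -> V -> W) x :
  (forall j, smooth_near x (f j)) -> smooth_near x (fun y => \sum_(j <- s) f j y).
Proof.
move=> hf; elim: s => [|j s IH].
  apply: smooth_near_ext (smooth_near_cst (0 : W) x).
  by near=> y; rewrite big_nil.
apply: smooth_near_ext (smooth_nearD (hf j) IH).
by near=> y; rewrite /= big_cons.
Unshelve. all: by end_near. Qed.

Lemma smooth_near_mxP V m n (f : V -> 'M[R]_(m, n)) x :
  smooth_near x f <-> forall i j, smooth_near x (fun y => f y i j).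
Proof.
split=> [[A [oA Ax] fA] i j|hf].
  by exists A => // k; exact: (Ck_on_mxP _ _ oA).1.
(* There are finitely many entries, so one neighbourhood serves them all. *)
have : \forall y \near x, forall i j, smooth_near y (fun y => f y i j).
  apply: filter_forall => i; apply: filter_forall => j.
  exact: smooth_near_near.
move=> /near_open_nbhs[B [oB Bx] BA].
exists B => // k; apply/(Ck_on_mxP _ _ oB) => i j.
by move: k; apply/(smooth_on_near _ oB) => y /BA.
Qed.

Lemma smooth_near_coord m n i j (x : 'M[R]_(m, n)) :
  smooth_near x (fun y : 'M[R]_(m, n) => y i j : R).
Proof.
exists setT; first by split=> //; exact: openT.
case=> [|k]; first by move=> y _; exact: coord_continuous.
split=> [y _|v]; first exact: differentiable_coord.
have -> : 'D_v (fun y : 'M[R]_(m, n) => y i j : R) = cst (v i j).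
  apply/funext => y; have := derive_id y v.
  by rewrite derive_mx // => /matrixP/(_ i j); rewrite mxE.
exact: Ck_on_cst.
Qed.

Lemma smooth_near_compR V n (f : V -> 'rV[R]_n) (g : 'rV[R]_n -> R) x :
  smooth_near x f -> smooth_near (f x) g -> smooth_near x (g \o f).
Proof.
move=> hf [B oB gB]; have := smooth_near_continuous hf (open_nbhs_nbhs oB).
move=> /near_open_nbhs[C [oC Cx] CB]; have [A [oA Ax] fA] := hf.
exists (A `&` C); first by split; [exact: openI|].
move=> k; apply: Ck_on_comp (gB k); first exact: openI.
  by move=> y [_ /CB].
exact: Ck_on_subset (@subIsetl _ _ _) (fA k).
Qed.

Lemma smooth_near_comp V n m p (f : V -> 'rV[R]_n)
    (g : 'rV[R]_n -> 'M[R]_(m, p)) x :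
  smooth_near x f -> smooth_near (f x) g -> smooth_near x (g \o f).
Proof.
move=> hf /smooth_near_mxP hg; apply/smooth_near_mxP => i j.
exact: smooth_near_compR hf (hg i j).
Qed.

Lemma smooth_near_derive_comm V (f : V -> R) x u v :
  smooth_near x f -> 'D_u ('D_v f) x = 'D_v ('D_u f) x.
Proof. by move=> [A [oA Ax] /(_ 2%N)]; exact: derive_derive_comm. Qed.

End smooth_near.

(** * Gradients and Jacobian matrices *)

Section jacobian.
Context {R : realType}.

Definition gradient n (f : 'rV[R]_n -> R) (x : 'rV[R]_n) : 'cV[R]_n :=
  \col_i 'D_(delta_mx 0 i) f x.

Lemma derive_gradient n (f : 'rV[R]_n -> R) x v : differentiable f x ->
  'D_v f x = (v *m gradient f x) 0 0.
Proof.
move=> df; rewrite deriveE // [in LHS](row_sum_delta v) linear_sum mxE.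
by apply: eq_bigr => j _; rewrite linearZ /= mxE deriveE.
Qed.

Lemma gradient_near n (f g : 'rV[R]_n -> R) x : (\forall y \near x, f y = g y) ->
  gradient f x = gradient g x.
Proof. by move=> fg; apply/colP => j; rewrite !mxE; exact: near_eq_derive. Qed.

Lemma jacobianE m n (f : 'rV[R]_m -> 'rV[R]_n) x i j : differentiable f x ->
  jacobian f x i j = 'D_(delta_mx 0 i) (fun y => f y 0 j) x.
Proof.
move=> df; have := deriveEjacobian (delta_mx 0 i) df.
rewrite -rowE derive_mx; last exact: diff_derivable.
by move=> /rowP/(_ j); rewrite !mxE.
Qed.

Lemma jacobian_near m n (f g : 'rV[R]_m -> 'rV[R]_n) x :
  (\forall y \near x, f y = g y) -> differentiable f x ->
  jacobian f x = jacobian g x.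
Proof.
move=> fg df; have dg := near_eq_differentiable fg df.
apply/matrixP => i j.
apply: etrans (jacobianE i j df) (etrans _ (esym (jacobianE i j dg))).
by apply: near_eq_derive; apply: filterS fg => y ->.
Qed.

Lemma jacobian_id n (x : 'rV[R]_n) : jacobian id x = 1%:M.
Proof.
apply/row_matrixP => i; rewrite !rowE -deriveEjacobian ?mulmx1 ?derive_id //.
Qed.

Lemma gradient_comp m n (f : 'rV[R]_m -> 'rV[R]_n) (g : 'rV[R]_n -> R) x :
  differentiable f x -> differentiable g (f x) ->
  gradient (g \o f) x = jacobian f x *m gradient g (f x).
Proof.
move=> df dg; apply/colP => i; rewrite mxE derive_comp_rV // mxE.
by apply: eq_bigr => j _; rewrite jacobianE // mxE.
Qed.

Lemma jacobian_comp m n p (f : 'rV[R]_m -> 'rV[R]_n)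
    (g : 'rV[R]_n -> 'rV[R]_p) x :
  differentiable f x -> differentiable g (f x) ->
  jacobian (g \o f) x = jacobian f x *m jacobian g (f x).
Proof.
move=> df dg; have dgf := differentiable_comp df dg.
apply/row_matrixP => i; rewrite !rowE mulmxA.
rewrite -(deriveEjacobian _ dgf) -(deriveEjacobian _ df) -(deriveEjacobian _ dg).
rewrite (deriveE _ dgf) (deriveE _ df) (deriveE _ dg).
by have /(congr1 (@^~ (delta_mx 0 i))) := diff_comp df dg.
Qed.

End jacobian.

(** * Functions on manifolds *)

Section smooth_near_matrix.
Context {R : realType} {V : normedModType R}.

Lemma smooth_near_mulmx m n p (f : V -> 'M[R]_(m, n)) (g : V -> 'M[R]_(n, p)) x :
  smooth_near x f -> smooth_near x g -> smooth_near x (fun y => f y *m g y).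
Proof.
move=> /smooth_near_mxP hf /smooth_near_mxP hg; apply/smooth_near_mxP => i j.
apply: smooth_near_ext
  (smooth_near_sum (index_enum 'I_n) (fun k => smooth_nearM (hf i k) (hg k j))).
by near=> y; rewrite mxE.
Unshelve. all: by end_near. Qed.

Lemma smooth_near_trmx m n (f : V -> 'M[R]_(m, n)) x :
  smooth_near x f -> smooth_near x (fun y => (f y)^T).
Proof.
move=> /smooth_near_mxP hf; apply/smooth_near_mxP => i j.
by apply: smooth_near_ext (hf j i); near=> y; rewrite mxE.
Unshelve. all: by end_near. Qed.

Lemma smooth_near_gradient n (f : 'rV[R]_n -> R) x :
  smooth_near x f -> smooth_near x (gradient f).
Proof.
move=> hf; apply/smooth_near_mxP => i j.
apply: smooth_near_ext (smooth_near_derive (delta_mx 0 i) hf).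
by near=> y; rewrite mxE.
Unshelve. all: by end_near. Qed.

Lemma smooth_near_jacobian m n (f : 'rV[R]_m -> 'rV[R]_n) x :
  smooth_near x f -> smooth_near x (jacobian f).
Proof.
move=> hf; apply/smooth_near_mxP => i j.
apply: smooth_near_ext
  (smooth_near_derive (delta_mx 0 i) ((smooth_near_mxP _ _).1 hf 0 j)).
apply: filterS (smooth_near_near hf) => y /smooth_near_differentiable df.
by rewrite (jacobianE i j df).
Qed.

End smooth_near_matrix.

Section charts.
Context {R : realType} {n : nat} {M : manifold R n}.
Implicit Types (p q : M) (f g : M -> R).

(** [param p] inverts [chart p] only over the image of the chart domain. That image is open, so the
    inversion identities hold near the point together with the transported property. *)
Lemma near_chart p q (P : M -> Prop) : chart_dom p q ->
  (\forall r \near q, P r) ->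
  \forall y \near chart p q,
    [/\ P (param p y), chart_dom p (param p y) & chart p (param p y) = y].
Proof.
move=> pq qP; have cq : (chart p @` chart_dom p) (chart p q) by exists q.
have c : param p @ chart p q --> param p (chart p q) := param_continuous cq.
rewrite chartK // in c.
have n1 : \forall y \near chart p q, P (param p y) := c _ qP.
have n2 := open_nbhs_nbhs (conj (@chart_codom_open _ _ M p) cq).
apply: filterS (filterI n1 n2) => y [+ [r pr E]].
by rewrite -E (chartK pr) => Pr; split.
Qed.

Lemma near_chart_dom p q : chart_dom p q -> \forall r \near q, chart_dom p r.
Proof.
by move=> pq; exact: open_nbhs_nbhs (conj (@chart_dom_open _ _ M p) pq).
Qed.

Lemma near_param p q (P : 'rV[R]_n -> Prop) : chart_dom p q ->
  (\forall y \near chart p q, P y) -> \forall r \near q, P (chart p r).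
Proof. by move=> /chart_continuous c cP; exact: (c _ cP). Qed.

Lemma chart_image_open p (A : set M) : open A ->
  open (chart p @` (A `&` chart_dom p)).
Proof.
move=> oA; rewrite openE => _ [q [Aq pq] <-].
apply: filterS (near_chart pq (open_nbhs_nbhs (conj oA Aq))) => y [h1 h2 h3].
by exists (param p y).
Qed.

Lemma smooth_near_transition p q r : chart_dom p r -> chart_dom q r ->
  smooth_near (chart p r) (chart q \o param p).
Proof.
move=> pr qr; apply: (smooth_on_near _ _).1 (chart_compatible p q) _ _.
  by rewrite setIC; apply: chart_image_open; exact: chart_dom_open.
by exists r.
Qed.

(** [smooth_fun_on] quantifies over all charts; compatibility of the atlas reduces this to a single
    chart around the point. *)
Lemma smooth_fun_nearP p q f : chart_dom p q ->
  smooth_fun_near q f <-> smooth_near (chart p q) (f \o param p).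
Proof.
move=> pq; split=> [[A [oA Aq /(_ p) fA]]|hf].
  by apply: (smooth_on_near _ (chart_image_open oA)).1 fA _ _; exists q.
have : \forall r \near q,
    chart_dom p r /\ smooth_near (chart p r) (f \o param p).
  apply: filterI; first exact: near_chart_dom.
  exact: (near_param pq (smooth_near_near hf)).
move=> /near_open_nbhs[A [oA Aq] hA]; exists A; split=> // p'.
apply/(smooth_on_near _ (chart_image_open oA)) => _ [r [Ar p'r] <-].
have [pr fr] := hA r Ar.
have := smooth_near_compR (smooth_near_transition p'r pr).
rewrite /= chartK // => /(_ _ fr); apply: smooth_near_ext.
apply: filterS (near_chart p'r (near_chart_dom pr)) => y [h1 h2 h3] /=.
by rewrite chartK.
Qed.

Lemma smooth_fun_near_center p f :
  smooth_fun_near p f <-> smooth_near (chart p p) (f \o param p).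
Proof. exact/smooth_fun_nearP/chart_dom_center. Qed.

Lemma smooth_fun_near_near p f : smooth_fun_near p f ->
  \forall q \near p, smooth_fun_near q f.
Proof.
move=> [A [oA Ap fA]]; apply: filterS (open_nbhs_nbhs (conj oA Ap)) => q Aq.
by exists A.
Qed.

Lemma smooth_fun_near_ext p f g : (\forall q \near p, f q = g q) ->
  smooth_fun_near p f -> smooth_fun_near p g.
Proof.
move=> fg /smooth_fun_near_center hf; apply/smooth_fun_near_center.
apply: smooth_near_ext hf.
by apply: filterS (near_chart (chart_dom_center p) fg) => y [].
Qed.

Lemma smooth_fun_near_cst p (c : R) : smooth_fun_near p (fun=> c).
Proof. apply/smooth_fun_near_center; exact: (@smooth_near_cst R _ R^o). Qed.

Lemma smooth_fun_nearM p f g : smooth_fun_near p f -> smooth_fun_near p g ->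
  smooth_fun_near p (f \* g).
Proof.
move=> /smooth_fun_near_center hf /smooth_fun_near_center hg.
apply/smooth_fun_near_center; exact: smooth_nearM hf hg.
Qed.

Lemma smooth_fun_nearB p f g : smooth_fun_near p f -> smooth_fun_near p g ->
  smooth_fun_near p (f \- g).
Proof.
move=> /smooth_fun_near_center hf /smooth_fun_near_center hg.
apply/smooth_fun_near_center; exact: smooth_nearB hf hg.
Qed.

Lemma smooth_fun_nearV p f : f p != 0 -> smooth_fun_near p f ->
  smooth_fun_near p (fun q => (f q)^-1).
Proof.
move=> fp /smooth_fun_near_center hf; apply/smooth_fun_near_center.
by apply: smooth_nearV hf; rewrite /= chartK //; exact: chart_dom_center.
Qed.

Lemma smooth_fun_near_neq0 p f : f p != 0 -> smooth_fun_near p f ->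
  \forall q \near p, f q != 0.
Proof.
move=> fp /smooth_fun_near_center/smooth_near_continuous c.
have pp := chart_dom_center p.
have c' : (f \o param p) y @[y --> chart p p] --> (f \o param p) (chart p p) := c.
rewrite [X in _ --> X]/= (chartK pp) in c'.
have n0 : \forall q \near p, f (param p (chart p q)) != 0.
  exact: near_param pp (cvgr_neq0 _ c' fp).
by apply: filterS (filterI (near_chart_dom pp) n0) => q [pq]; rewrite (chartK pq).
Qed.

Definition coordinate p (k : 'I_n) : M -> R := fun q => chart p q 0 k.

Lemma smooth_coordinate p q k : chart_dom p q ->
  smooth_fun_near q (coordinate p k).
Proof.
move=> pq; apply/(smooth_fun_nearP _ pq).
apply: smooth_near_ext (smooth_near_coord 0 k (chart p q)).
apply: filterS (near_chart pq (near_chart_dom pq)) => y [_ _ E].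
by rewrite /coordinate /= E.
Qed.

Lemma transition_mx_id p q : chart_dom p q -> transition_mx p p q = 1%:M.
Proof.
move=> pq; rewrite /transition_mx -(jacobian_id (chart p q)).
apply: jacobian_near; last first.
  exact/smooth_near_differentiable/smooth_near_transition.
by apply: filterS (near_chart pq (near_chart_dom pq)) => y [].
Qed.

Lemma transition_mx_cocycle p q s r :
  chart_dom p r -> chart_dom q r -> chart_dom s r ->
  transition_mx p q r *m transition_mx q s r = transition_mx p s r.
Proof.
move=> pr qr sr; rewrite /transition_mx.
have h1 := smooth_near_differentiable (smooth_near_transition pr qr).
have h2 := smooth_near_differentiable (smooth_near_transition qr sr).
have E : (chart q \o param p) (chart p r) = chart q r by rewrite /= chartK.
have h2' : differentiable (chart s \o param q)
    ((chart q \o param p) (chart p r)) by rewrite E.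
have := jacobian_comp h1 h2'; rewrite E => <-.
apply: jacobian_near; last exact: differentiable_comp h1 h2'.
apply: filterS (near_chart pr (near_chart_dom qr)) => y [h _ _] /=.
by rewrite chartK.
Qed.

Lemma differentialE p f : smooth_fun_near p f ->
  differential f p = gradient (f \o param p) (chart p p).
Proof.
move=> /smooth_fun_near_center/smooth_near_differentiable df.
by apply/colP => j; rewrite !mxE deriveE.
Qed.

(** The components of [differential f q] refer to the chart centred at [q], which changes
    arbitrarily with [q]. Passing to the fixed chart [p] gives components whose dependence on [q]
    can be differentiated. *)
Lemma differential_in_chart p q f : chart_dom p q -> smooth_fun_near q f ->
  differential f q = transition_mx q p q *m gradient (f \o param p) (chart p q).
Proof.
move=> pq hf; have qq := chart_dom_center q; rewrite differentialE //.
have d1 := smooth_near_differentiable (smooth_near_transition qq pq).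
have d2 := smooth_near_differentiable ((smooth_fun_nearP _ pq).1 hf).
have E : (chart p \o param q) (chart q q) = chart p q by rewrite /= chartK.
have d2' : differentiable (f \o param p)
    ((chart p \o param q) (chart q q)) by rewrite E.
have := gradient_comp d1 d2'; rewrite E => <-; apply: gradient_near.
apply: filterS (near_chart qq (near_chart_dom pq)) => y [h _ _] /=.
by rewrite chartK.
Qed.

Lemma differential_coordinate p q k : chart_dom p q ->
  differential (coordinate p k) q = transition_mx q p q *m delta_mx k 0.
Proof.
move=> pq; rewrite (differential_in_chart pq (smooth_coordinate k pq)).
congr (_ *m _); rewrite (gradient_near (g := fun y => y 0 k)); last first.
  apply: filterS (near_chart pq (near_chart_dom pq)) => y [_ _ E].
  by rewrite /coordinate /= E.
apply/colP => j; rewrite !mxE; have := derive_id (chart p q) (delta_mx 0 j).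
by rewrite derive_mx // => /rowP/(_ k); rewrite !mxE eqxx eq_sym /= andbT.
Qed.

Lemma differential_near p f g : (\forall q \near p, f q = g q) ->
  smooth_fun_near p f -> differential f p = differential g p.
Proof.
move=> fg hf; have hg := smooth_fun_near_ext fg hf.
rewrite !differentialE //; apply: gradient_near.
by apply: filterS (near_chart (chart_dom_center p) fg) => y [].
Qed.

Lemma differentialM p f g : smooth_fun_near p f -> smooth_fun_near p g ->
  differential (f \* g) p = f p *: differential g p + g p *: differential f p.
Proof.
move=> hf hg; rewrite !differentialE //; last exact: smooth_fun_nearM.
move: hf hg => /smooth_fun_near_center/smooth_near_differentiable hf.
move=> /smooth_fun_near_center/smooth_near_differentiable hg.
apply/colP => j; rewrite !mxE deriveM; try exact: diff_derivable.
by rewrite /= chartK //; exact: chart_dom_center.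
Qed.

Lemma differentialB p f g : smooth_fun_near p f -> smooth_fun_near p g ->
  differential (f \- g) p = differential f p - differential g p.
Proof.
move=> hf hg; rewrite !differentialE //; last exact: smooth_fun_nearB.
move: hf hg => /smooth_fun_near_center/smooth_near_differentiable hf.
move=> /smooth_fun_near_center/smooth_near_differentiable hg.
by apply/colP => j; rewrite !mxE deriveB //; exact: diff_derivable.
Qed.

Lemma differential_cst p (c : R) : differential (fun _ : M => c) p = 0.
Proof.
rewrite differentialE; last exact: smooth_fun_near_cst.
by apply/colP => j; rewrite !mxE; exact: (@derive_cst R _ R^o).
Qed.

End charts.

(** * Exterior derivative and pullback *)

Section flat_exterior_derivative.
Context {R : realType}.

Lemma derive_comp (U V W : normedModType R) (f : U -> V) (g : V -> W) x v :
  differentiable f x -> differentiable g (f x) ->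
  'D_v (g \o f) x = 'D_('D_v f x) g (f x).
Proof.
move=> df dg; have dgf := differentiable_comp df dg.
rewrite (deriveE _ dgf) (deriveE _ dg) (deriveE _ df).
by have /(congr1 (@^~ v)) := diff_comp df dg.
Qed.

Lemma derive_mulmx (V : normedModType R) m n p (f : V -> 'M[R]_(m, n))
    (g : V -> 'M[R]_(n, p)) x v : differentiable f x -> differentiable g x ->
  'D_v (fun y => f y *m g y) x = 'D_v f x *m g x + f x *m 'D_v g x.
Proof.
move=> df dg.
have dfc i j := diff_derivable (v := v) ((differentiable_mxP _ _).1 df i j).
have dgc i j := diff_derivable (v := v) ((differentiable_mxP _ _).1 dg i j).
have E i j : (fun y => (f y *m g y) i j) =
    \sum_(k < n) ((fun y => f y i k) * (fun y => g y k j)).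
  by apply/funext => y; rewrite mxE fct_sumE.
have dfg i j : derivable (fun y => (f y *m g y) i j) x v.
  by rewrite E; apply: derivable_sum => k; exact: derivableM.
rewrite derive_mx; last by apply/derivable_mxP.
apply/matrixP => i j; rewrite !mxE E derive_sum; last first.
  by move=> k; exact: derivableM.
rewrite -big_split; apply: eq_bigr => k _ /=.
rewrite deriveM //.
rewrite (derive_mx (diff_derivable df)) (derive_mx (diff_derivable dg)) !mxE.
by rewrite addrC; congr (_ + _); exact: mulrC.
Qed.

Lemma derive_trmx (V : normedModType R) m n (f : V -> 'M[R]_(m, n)) x v :
  differentiable f x -> 'D_v (fun y => (f y)^T) x = ('D_v f x)^T.
Proof.
move=> df; have dfc := (differentiable_mxP _ _).1 df.
rewrite derive_mx; last first.
  apply/derivable_mxP => i j; under eq_fun do rewrite mxE.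
  exact: diff_derivable.
rewrite (derive_mx (diff_derivable df)); apply/matrixP => i j; rewrite !mxE.
by under eq_fun do rewrite mxE.
Qed.

Lemma form2N n (W : 'M[R]_n) X Y : W^T = - W -> form2 W X Y = - form2 W Y X.
Proof.
move=> sW; rewrite /form2 -[in LHS](trmxK (X *m W *m Y^T)) [in LHS]mxE.
by rewrite !trmx_mul trmxK sW mulNmx mulmxN mxE mulmxA.
Qed.

Lemma form2Dm n (W1 W2 : 'M[R]_n) X Y :
  form2 (W1 + W2) X Y = form2 W1 X Y + form2 W2 X Y.
Proof. by rewrite /form2 mulmxDr mulmxDl mxE. Qed.

Lemma form2Zm n (W : 'M[R]_n) c X Y : form2 (c *: W) X Y = c * form2 W X Y.
Proof. by rewrite /form2 -scalemxAr -scalemxAl mxE. Qed.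

Lemma form2Zl n (W : 'M[R]_n) c X Y : form2 W (c *: X) Y = c * form2 W X Y.
Proof. by rewrite /form2 -!scalemxAl mxE. Qed.

Lemma form2Zr n (W : 'M[R]_n) c X Y : form2 W X (c *: Y) = c * form2 W X Y.
Proof. by rewrite /form2 linearZ /= -scalemxAr mxE. Qed.

Lemma form2_pullback m n (J : 'M[R]_(m, n)) (W : 'M[R]_n) X Y :
  form2 (J *m W *m J^T) X Y = form2 W (X *m J) (Y *m J).
Proof. by rewrite /form2 trmx_mul !mulmxA. Qed.

Lemma derive_form2 (V : normedModType R) n (W : V -> 'M[R]_n) X Y x v :
  differentiable W x -> 'D_v (fun y => form2 (W y) X Y) x = form2 ('D_v W x) X Y.
Proof.
move=> dW; have dXW : differentiable (fun y => X *m W y) x.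
  apply/differentiable_mxP => i j.
  have -> : (fun y => (X *m W y) i j) = \sum_k (fun y => X i k *: W y k j).
    by apply/funext => y; rewrite mxE fct_sumE.
  apply: differentiable_sum => k; apply: differentiableZ.
  exact: (differentiable_mxP _ _).1 dW k j.
have dc p q (A : 'M[R]_(p, q)) : differentiable (fun _ : V => A) x by [].
have -> : form2 ('D_v W x) X Y = ('D_v (fun y => X *m W y *m Y^T) x) 0 0.
  rewrite (derive_mulmx v dXW (dc _ _ Y^T)) (derive_mulmx v (dc _ _ X) dW).
  by rewrite !derive_cst mul0mx mulmx0 add0r addr0.
rewrite derive_mx ?mxE //; apply/diff_derivable/differentiable_mxP => i j.
have -> : (fun y => (X *m W y *m Y^T) i j) =
    \sum_k (fun y => Y^T k j *: (X *m W y) i k).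
  apply/funext => y; rewrite mxE fct_sumE.
  by apply: eq_bigr => k _; rewrite mulrC.
apply: differentiable_sum => k; apply: differentiableZ.
exact: (differentiable_mxP _ _).1 dXW i k.
Qed.

(** Koszul's formula again, but with the matrix [W] differentiated before it is evaluated on
    vectors, so that the Leibniz rule for matrix products applies. *)
Definition flat_ext_d n (W : 'rV[R]_n -> 'M[R]_n) (x X Y Z : 'rV[R]_n) : R :=
  form2 ('D_X W x) Y Z + form2 ('D_Y W x) Z X + form2 ('D_Z W x) X Y.

Lemma flat_ext_dZ n (W : 'rV[R]_n -> 'M[R]_n) (x X Y Z : 'rV[R]_n) c :
  differentiable W x -> flat_ext_d W x X Y (c *: Z) = c * flat_ext_d W x X Y Z.
Proof.
move=> dW; have E : 'D_(c *: Z) W x = c *: 'D_Z W x.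
  by rewrite (deriveE (c *: Z) dW) (deriveE Z dW) linearZ.
rewrite /flat_ext_d mulrDr mulrDr; congr (_ + _ + _); first exact: form2Zr.
  exact: form2Zl.
exact: etrans (congr1 (fun A => form2 A X Y) E) (form2Zm _ c X Y).
Qed.

Lemma flat_ext_d_near n (W1 W2 : 'rV[R]_n -> 'M[R]_n) (x X Y Z : 'rV[R]_n) :
  (\forall y \near x, W1 y = W2 y) ->
  flat_ext_d W1 x X Y Z = flat_ext_d W2 x X Y Z.
Proof. by move=> E; rewrite /flat_ext_d !(near_eq_derive _ E). Qed.

(** [F] stands for the 2-form at the image point, [x] for the image of a vector [X], and [yx] for
    the second derivative of the map along [Y] and [X]. In this abstract form the cancellation is an
    identity in a commutative ring. *)
Lemma skew_cyclic_cancel (T : Type) (F : T -> T -> R) (t1 t2 t3 : R)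
    (yx xy zx xz zy yz : T) : (forall u v, F u v = - F v u) ->
  yx = xy -> zx = xz -> zy = yz -> forall x y z,
  (F yx z + F y zx + t1) + (F zy x + F z xy + t2) + (F xz y + F x yz + t3) =
  t1 + t2 + t3.
Proof.
move=> FN -> -> -> x y z; rewrite (FN y xz) (FN z xy) (FN x yz); ring.
Qed.

(* The second derivatives of [f] cancel in the cyclic sum because they are
   symmetric while [W] is skew. *)
Lemma flat_ext_d_pullback m n (f : 'rV[R]_m -> 'rV[R]_n)
    (W : 'rV[R]_n -> 'M[R]_n) x X Y Z :
  smooth_near x f -> smooth_near (f x) W -> (W (f x))^T = - W (f x) ->
  flat_ext_d (fun y => jacobian f y *m W (f y) *m (jacobian f y)^T) x X Y Z =
  flat_ext_d W (f x) (X *m jacobian f x) (Y *m jacobian f x) (Z *m jacobian f x).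
Proof.
move=> hf hW skW; set J := jacobian f x.
have df := smooth_near_differentiable hf.
have dW := smooth_near_differentiable hW.
have hJ := smooth_near_jacobian hf.
have hWf := smooth_near_comp hf hW.
have dJ := smooth_near_differentiable hJ.
have dWf := smooth_near_differentiable hWf.
have dJW := smooth_near_differentiable (smooth_near_mulmx hJ hWf).
have dJT := smooth_near_differentiable (smooth_near_trmx hJ).
pose H v := 'D_v (jacobian f) x.
(* Contracting the Jacobian with a constant row [a] gives ['D_a f], so this is the symmetry of
   second derivatives, applied to each component of [f]. *)
have HC u v : u *m H v = v *m H u.
  have E a b : a *m H b = 'D_b ('D_a f) x.
    have dc : differentiable (fun _ : 'rV[R]_m => a) x by [].
    have := derive_mulmx b dc dJ; rewrite derive_cst mul0mx add0r => <-.
    apply: near_eq_derive; apply: filterS (smooth_near_near hf) => y.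
    by move=> /smooth_near_differentiable dfy; rewrite deriveEjacobian.
  rewrite !E; apply/rowP => j.
  have hj : smooth_near x (fun y => f y 0 j) := (smooth_near_mxP _ _).1 hf 0 j.
  have C a b : ('D_b ('D_a f) x) 0 j = 'D_b ('D_a (fun y => f y 0 j)) x.
    have da := smooth_near_derive a hf.
    rewrite (derive_mx (smooth_near_derivable (v := b) da)) mxE.
    apply: near_eq_derive; apply: filterS (smooth_near_near hf) => y.
    by move=> /(smooth_near_derivable (v := a)) dfy; rewrite (derive_mx dfy) mxE.
  exact: etrans (C u v) (etrans (smooth_near_derive_comm v u hj) (esym (C v u))).
(* [T] is the term in which [W] itself is differentiated; its cyclic sum is the right-hand side. The
   two other terms carry the second derivatives of [f]. *)
have [T TE D] : exists2 T : 'rV_m -> 'rV_m -> 'rV_m -> R,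
    forall v A B, T v A B = form2 ('D_(v *m J) W (f x)) (A *m J) (B *m J) &
    forall v A B,
    form2 ('D_v (fun y => jacobian f y *m W (f y) *m (jacobian f y)^T) x) A B =
    form2 (W (f x)) (A *m H v) (B *m J) + form2 (W (f x)) (A *m J) (B *m H v)
    + T v A B.
  exists (fun v A B => form2 ('D_(v *m J) W (f x)) (A *m J) (B *m J)) => // v A B.
  rewrite (derive_mulmx v dJW dJT) (derive_mulmx v dJ dWf) (derive_trmx v dJ).
  rewrite -/(H v) -/J (derive_comp v df dW) (deriveEjacobian v df) -/J.
  rewrite mulmxDl !form2Dm form2_pullback addrAC.
  by rewrite /form2 !trmx_mul !mulmxA.
apply: etrans (congr2 +%R (congr2 +%R (D X Y Z) (D Y Z X)) (D Z X Y)) _.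
apply: etrans _ (congr2 +%R (congr2 +%R (TE X Y Z) (TE Y Z X)) (TE Z X Y)).
exact: (skew_cyclic_cancel _ _ _ (fun u v => form2N u v skW)
  (HC Y X) (HC Z X) (HC Z Y) (X *m J) (Y *m J) (Z *m J)).
Qed.

End flat_exterior_derivative.

(** * Tensor fields and smooth maps *)

Section bivectors.
Context {R : realType}.

Lemma bivecZl n (B : 'M[R]_n) c a b : bivec B (c *: a) b = c * bivec B a b.
Proof. by rewrite /bivec linearZ /= -!scalemxAl mxE. Qed.

Lemma bivecDr n (B : 'M[R]_n) a b1 b2 :
  bivec B a (b1 + b2) = bivec B a b1 + bivec B a b2.
Proof. by rewrite /bivec mulmxDr mxE. Qed.

Lemma bivecZr n (B : 'M[R]_n) a c b : bivec B a (c *: b) = c * bivec B a b.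
Proof. by rewrite /bivec -scalemxAr mxE. Qed.

Lemma bivecNr n (B : 'M[R]_n) a b : bivec B a (- b) = - bivec B a b.
Proof. by rewrite /bivec mulmxN mxE. Qed.

Lemma bivec0l n (B : 'M[R]_n) b : bivec B 0 b = 0.
Proof. by rewrite /bivec trmx0 !mul0mx mxE. Qed.

Lemma bivec0r n (B : 'M[R]_n) a : bivec B a 0 = 0.
Proof. by rewrite /bivec mulmx0 mxE. Qed.

Lemma bivec_delta n (B : 'M[R]_n) (j k : 'I_n) :
  bivec B (delta_mx j 0) (delta_mx k 0) = B j k.
Proof. by rewrite /bivec trmx_delta -rowE -colE !mxE. Qed.

Lemma bivec_pullback m n (T : 'M[R]_(m, n)) (B : 'M[R]_m) a b :
  bivec B (T *m a) (T *m b) = bivec (T^T *m B *m T) a b.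
Proof. by rewrite /bivec trmx_mul !mulmxA. Qed.

Lemma bivecC n (B : 'M[R]_n) a b : B^T = - B -> bivec B a b = - bivec B b a.
Proof.
move=> sB; rewrite /bivec -[in LHS](trmxK (a^T *m B *m b)) [in LHS]mxE.
by rewrite !trmx_mul trmxK sB mulNmx mulmxN mxE mulmxA.
Qed.

Lemma bivec_diag n (B : 'M[R]_n) a : B^T = - B -> bivec B a a = 0.
Proof.
move=> /(bivecC a a) /eqP; rewrite -addr_eq0 -mulr2n -mulr_natr mulf_eq0.
by rewrite pnatr_eq0 orbF => /eqP.
Qed.

(** Skewness kills the component along [a] of the second argument. With [a = eta], this is why the
    bracket with a function vanishing on the hypersurface sees only the restriction of the other
    function. *)
Lemma bivec_line n (B : 'M[R]_n) c d a v : B^T = - B ->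
  bivec B (c *: a) (v + d *: a) = c * bivec B a v.
Proof.
by move=> sB; rewrite bivecZl bivecDr bivecZr bivec_diag // mulr0 addr0.
Qed.

End bivectors.

Section tensor_fields.
Context {R : realType} {n : nat} {M : manifold R n}.
Implicit Types (p q : M) (f g : M -> R) (L : M -> 'M[R]_n) (X : M -> 'rV[R]_n).

Lemma bracket_in_chart L p q f g : chart_dom p q ->
  smooth_fun_near q f -> smooth_fun_near q g ->
  bracket L f g q =
  ((gradient (f \o param p) (chart p q))^T *m bivector_in_chart L p q *m
     gradient (g \o param p) (chart p q)) 0 0.
Proof.
move=> pq hf hg; rewrite /bracket /bivec.
rewrite (differential_in_chart pq hf) (differential_in_chart pq hg).
by rewrite trmx_mul /bivector_in_chart !mulmxA.
Qed.

Lemma lie_fun_in_chart X p q f : chart_dom p q -> smooth_fun_near q f ->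
  lie_fun X f q =
  (vector_in_chart X p q *m gradient (f \o param p) (chart p q)) 0 0.
Proof.
move=> pq hf; rewrite /lie_fun /pairing (differential_in_chart pq hf).
by rewrite mulmxA.
Qed.

Lemma near_chart_smooth p f : smooth_fun_near p f ->
  \forall y \near chart p p, [/\ smooth_fun_near (param p y) f,
    chart_dom p (param p y) & chart p (param p y) = y].
Proof.
by move=> /smooth_fun_near_near; apply: near_chart; exact: chart_dom_center.
Qed.

Lemma smooth_bracket L p f g : bivector_field L ->
  smooth_fun_near p f -> smooth_fun_near p g -> smooth_fun_near p (bracket L f g).
Proof.
move=> [_ /(_ p) sL] hf hg; have pp := chart_dom_center p.
have oc := @chart_codom_open _ _ M p.
have cp : (chart p @` chart_dom p) (chart p p) by exists p.
have hL := (smooth_on_near _ oc).1 sL _ cp.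
have hf' := smooth_near_gradient ((smooth_fun_near_center _ _).1 hf).
have hg' := smooth_near_gradient ((smooth_fun_near_center _ _).1 hg).
have h := smooth_near_mulmx (smooth_near_mulmx (smooth_near_trmx hf') hL) hg'.
apply/smooth_fun_near_center.
apply: smooth_near_ext ((smooth_near_mxP _ _).1 h 0 0).
apply: filterS (filterI (near_chart_smooth hf) (near_chart_smooth hg)) => y.
move=> [[fy py cy] [gy _ _]] /=.
by have := bracket_in_chart L py fy gy; rewrite cy.
Qed.

Lemma smooth_lie_fun X p f : vector_field X ->
  smooth_fun_near p f -> smooth_fun_near p (lie_fun X f).
Proof.
move=> /(_ p) sX hf; have pp := chart_dom_center p.
have oc := @chart_codom_open _ _ M p.
have cp : (chart p @` chart_dom p) (chart p p) by exists p.
have hX := (smooth_on_near _ oc).1 sX _ cp.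
have hf' := smooth_near_gradient ((smooth_fun_near_center _ _).1 hf).
have h := smooth_near_mulmx hX hf'.
apply/smooth_fun_near_center.
apply: smooth_near_ext ((smooth_near_mxP _ _).1 h 0 0).
apply: filterS (near_chart_smooth hf) => y [fy py cy] /=.
by have := lie_fun_in_chart X py fy; rewrite cy.
Qed.

Lemma smooth_on_codomP p m k (f : M -> 'M[R]_(m, k)) :
  (forall q i j, chart_dom p q -> smooth_fun_near q (fun r => f r i j)) ->
  smooth_on (chart p @` chart_dom p) (fun y => f (param p y)).
Proof.
move=> hf; apply/(smooth_on_near _ (@chart_codom_open _ _ M p)).
move=> _ [q pq <-]; apply/smooth_near_mxP => i j.
exact: (smooth_fun_nearP _ pq).1 (hf q i j pq).
Qed.

(** The components of a field in a chart are its values on the coordinate functions of that chart,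
    so a field known through its action on functions can be proved smooth. *)
Lemma vector_fieldP X :
  (forall p q k, chart_dom p q ->
    smooth_fun_near q (lie_fun X (coordinate p k))) ->
  vector_field X.
Proof.
move=> hX p; apply: smooth_on_codomP => q i k pq.
apply: smooth_fun_near_ext (hX p q k pq).
apply: filterS (near_chart_dom pq) => r pr.
by rewrite /lie_fun /pairing differential_coordinate // mulmxA -colE mxE (ord1 i).
Qed.

Lemma bivector_fieldP L : (forall p, (L p)^T = - L p) ->
  (forall p q j k, chart_dom p q ->
    smooth_fun_near q (bracket L (coordinate p j) (coordinate p k))) ->
  bivector_field L.
Proof.
move=> sL hL; split=> // p; apply: smooth_on_codomP => q j k pq.
apply: smooth_fun_near_ext (hL p q j k pq).
apply: filterS (near_chart_dom pq) => r pr.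
rewrite /bracket /bivec !differential_coordinate // trmx_mul trmx_delta.
transitivity (((delta_mx 0 j : 'rV_n) *m bivector_in_chart L p r *m
    (delta_mx k 0 : 'cV_n)) 0 0).
  by rewrite /bivector_in_chart !mulmxA.
by move: (bivector_in_chart L p r) => B; rewrite -rowE -colE !mxE.
Qed.

Lemma bracketC L f g p : (L p)^T = - L p -> bracket L f g p = - bracket L g f p.
Proof. exact: bivecC. Qed.

Lemma ext_dE (W : M -> 'M[R]_n) p (u v w : 'rV[R]_n) : form2_field W ->
  ext_d W p u v w =
  flat_ext_d (fun y => form2_in_chart W p (param p y)) (chart p p) u v w.
Proof.
move=> [_ /(_ p) sW].
have cp : (chart p @` chart_dom p) (chart p p).
  by exists p => //; exact: chart_dom_center.
have dW := smooth_near_differentiable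
  ((smooth_on_near _ (@chart_codom_open _ _ M p)).1 sW _ cp).
by apply: etrans (congr2 +%R (congr2 +%R (derive_form2 v w u dW)
  (derive_form2 w u v dW)) (derive_form2 u v w dW)) _.
Qed.

(** Serves with [c = 0], to make [dW] vanish on [E], and with [c = E s], to extract the factor
    common to all terms of the final identity. *)
Lemma ext_dZ (W : M -> 'M[R]_n) p (c : R) (u v w : 'rV[R]_n) : form2_field W ->
  ext_d W p u v (c *: w) = c * ext_d W p u v w.
Proof.
move=> fW; rewrite !ext_dE //; apply: flat_ext_dZ.
have cp : (chart p @` chart_dom p) (chart p p).
  by exists p => //; exact: chart_dom_center.
exact: (smooth_near_differentiable
  ((smooth_on_near _ (@chart_codom_open _ _ M p)).1 (fW.2 p) _ cp)).
Qed.

End tensor_fields.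

(** [S] and [S'] are a change of chart at the image point and its inverse. Inserting their product
    compares the pullback in the charts centred at the moving points with the one in charts fixed
    around a base point. *)
Lemma pullback_mx_change_basis (R : comNzRingType) m n (P : 'M[R]_m)
    (T : 'M[R]_(m, n)) (S S' W : 'M[R]_n) : S *m S' = 1%:M ->
  P *m (T *m W *m T^T) *m P^T =
  P *m T *m S *m (S' *m W *m S'^T) *m (P *m T *m S)^T.
Proof.
move=> SS; have E : P *m T *m S *m S' = P *m T by rewrite -mulmxA SS mulmx1.
transitivity ((P *m T *m S *m S') *m W *m (P *m T *m S *m S')^T).
  by rewrite E trmx_mul !mulmxA.
by rewrite [in LHS](trmx_mul _ S') !mulmxA.
Qed.

Section smooth_maps.
Context {R : realType} {m n : nat} {M : manifold R m} {N : manifold R n}.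
Context {A : set M} {F : M -> N} (oA : open A) (sF : smooth_map_on A F).
Implicit Types (p : M) (f g : N -> R).

Lemma smooth_map_continuous p : A p -> {for p, continuous F}.
Proof. exact: sF.1. Qed.

Lemma near_map p (P : N -> Prop) : A p -> (\forall q \near F p, P q) ->
  \forall q \near p, P (F q).
Proof. by move=> /smooth_map_continuous c /c. Qed.

Lemma smooth_near_map p p' q : A p -> chart_dom p' p -> chart_dom q (F p) ->
  smooth_near (chart p' p) (chart q \o F \o param p').
Proof.
move=> Ap pp qp; have oB : open (A `&` F @^-1` chart_dom q).
  rewrite openE => r [Ar qr]; apply: filterI.
    exact: open_nbhs_nbhs (conj oA Ar).
  exact: near_map Ar (near_chart_dom qr).
have := sF.2 p' q; rewrite setIAC => h.
apply: (smooth_on_near _ (chart_image_open oB)).1 h _ _.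
by exists p.
Qed.

(** The chain rule through the charts centred at [p] and [F p], the only ones in which [tangent_mx]
    is defined. *)
Lemma jacobian_map p p' q : A p -> chart_dom p' p -> chart_dom q (F p) ->
  jacobian (chart q \o F \o param p') (chart p' p) =
  transition_mx p' p p *m tangent_mx F p *m transition_mx (F p) q (F p).
Proof.
move=> Ap p'p qp.
have pp := chart_dom_center p; have FF := chart_dom_center (F p).
have d1 := smooth_near_differentiable (smooth_near_transition p'p pp).
have d2 := smooth_near_differentiable (smooth_near_map Ap pp FF).
have d3 := smooth_near_differentiable (smooth_near_transition FF qp).
have d2' : differentiable (chart (F p) \o F \o param p)
  ((chart p \o param p') (chart p' p)) by rewrite /= chartK.
have d3' : differentiable (chart q \o param (F p))
    (((chart (F p) \o F \o param p) \o (chart p \o param p')) (chart p' p)).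
  by rewrite /= !chartK.
have d12 := differentiable_comp d1 d2'.
have E := jacobian_comp d12 d3'; rewrite (jacobian_comp d1 d2') in E.
have e1 : (chart p \o param p') (chart p' p) = chart p p by rewrite /= chartK.
have e2 : ((chart (F p) \o F \o param p) \o (chart p \o param p')) (chart p' p)
   = chart (F p) (F p) by rewrite /= !chartK.
rewrite e1 e2 in E; rewrite /transition_mx /tangent_mx -E.
apply: jacobian_near; last first.
  exact: smooth_near_differentiable (smooth_near_map Ap p'p qp).
have n1 := near_chart p'p (near_chart_dom pp).
have n2 := near_chart p'p (near_map Ap (near_chart_dom FF)).
apply: filterS (filterI n1 n2) => y [[h1 _ _] [h2 _ _]] /=.
by rewrite !chartK.
Qed.

Lemma smooth_fun_near_comp p f : A p -> smooth_fun_near (F p) f ->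
  smooth_fun_near p (f \o F).
Proof.
move=> Ap hf; have pp := chart_dom_center p; have FF := chart_dom_center (F p).
have h := smooth_near_map Ap pp FF; apply/smooth_fun_near_center.
have hf' : smooth_near ((chart (F p) \o F \o param p) (chart p p))
    (f \o param (F p)).
  by rewrite /= (chartK pp); exact/smooth_fun_near_center.
apply: smooth_near_ext (smooth_near_compR h hf').
have n2 := near_chart pp (near_map Ap (near_chart_dom FF)).
by apply: filterS n2 => y [h2 _ _] /=; rewrite chartK.
Qed.

Lemma differential_comp p f : A p -> smooth_fun_near (F p) f ->
  differential (f \o F) p = tangent_mx F p *m differential f (F p).
Proof.
move=> Ap hf; have pp := chart_dom_center p; have FF := chart_dom_center (F p).
rewrite (differentialE hf) (differentialE (smooth_fun_near_comp Ap hf)).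
have d1 := smooth_near_differentiable (smooth_near_map Ap pp FF).
have e : (chart (F p) \o F \o param p) (chart p p) = chart (F p) (F p).
  by rewrite /= (chartK pp).
have d2 : differentiable (f \o param (F p))
    ((chart (F p) \o F \o param p) (chart p p)).
  by rewrite e; exact/smooth_near_differentiable/smooth_fun_near_center.
have := gradient_comp d1 d2; rewrite e => <-; apply: gradient_near.
have n2 := near_chart pp (near_map Ap (near_chart_dom FF)).
by apply: filterS n2 => y [h2 _ _] /=; rewrite chartK.
Qed.

(** In the fixed charts around [p] and [F p], the pointwise relation [W = F^* W0] becomes, on a
    neighbourhood, the pullback by the Jacobian of the local expression [phi]. The statement in flat
    space then applies. *)
Lemma ext_d_pullback (W : M -> 'M[R]_m) (W0 : N -> 'M[R]_n) p X Y Z :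
  form2_field W -> form2_field W0 -> is_pullback_on A F W W0 -> A p ->
  ext_d W p X Y Z = ext_d W0 (F p)
    (X *m tangent_mx F p) (Y *m tangent_mx F p) (Z *m tangent_mx F p).
Proof.
move=> fW fW0 WW0 Ap; rewrite (ext_dE _ _ _ _ fW) (ext_dE _ _ _ _ fW0).
have pp := chart_dom_center p; have FF := chart_dom_center (F p).
set phi := chart (F p) \o F \o param p.
have hphi : smooth_near (chart p p) phi := smooth_near_map Ap pp FF.
pose Om := fun z => form2_in_chart W0 (F p) (param (F p) z).
have e : phi (chart p p) = chart (F p) (F p) by rewrite /phi /= (chartK pp).
have cp : (chart (F p) @` chart_dom (F p)) (chart (F p) (F p)) by exists (F p).
have hOm : smooth_near (phi (chart p p)) Om.
  rewrite e.
  exact: (smooth_on_near _ (@chart_codom_open _ _ N (F p))).1 (fW0.2 (F p)) _ cp.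
have sOm : (Om (phi (chart p p)))^T = - Om (phi (chart p p)).
  by rewrite /Om /form2_in_chart !trmx_mul trmxK fW0.1 mulNmx mulmxN mulmxA.
have -> : tangent_mx F p = jacobian phi (chart p p) by [].
rewrite -e; apply: etrans _ (flat_ext_d_pullback X Y Z hphi hOm sOm).
apply: flat_ext_d_near.
have n1 := near_chart pp (open_nbhs_nbhs (conj oA Ap)).
have n2 := near_chart pp (near_map Ap (near_chart_dom FF)).
apply: filterS (filterI n1 n2) => y [[Aq pq qy] [Fq _ _]].
set q := param p y in Aq pq qy Fq *.
have -> : jacobian phi y = transition_mx p q q *m tangent_mx F q *m
    transition_mx (F q) (F p) (F q) by rewrite -qy jacobian_map.
have -> : Om (phi y) = form2_in_chart W0 (F p) (F q).
  by rewrite /Om /phi /= -/q (chartK Fq).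
have qq := chart_dom_center (F q).
rewrite /form2_in_chart (WW0 q Aq); apply: pullback_mx_change_basis.
by rewrite transition_mx_cocycle // transition_mx_id.
Qed.

End smooth_maps.

(** * Derivatives of functions along integral curves *)

Section integral_curves.
Context {R : realType} {n : nat} {M : manifold R n}.
Implicit Types (E : M -> 'rV[R]_n) (c : R -> M) (f : M -> R).

Lemma is_derive_along E c t f : {for t, continuous c} ->
  is_derive t (1 : R) (chart (c t) \o c) (E (c t)) ->
  smooth_fun_near (c t) f ->
  is_derive t (1 : R) (f \o c) (lie_fun E f (c t)).
Proof.
move=> cc [dc Dc] hf; have pp := chart_dom_center (c t).
have df := smooth_near_differentiable ((smooth_fun_near_center _ _).1 hf).
have dchart : differentiable (chart (c t) \o c) t by exact/derivable1_diffP.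
have E1 : \forall s \near t,
    ((f \o param (c t)) \o (chart (c t) \o c)) s = (f \o c) s.
  have n1 : \forall s \near t, chart_dom (c t) (c s) := cc _ (near_chart_dom pp).
  by apply: filterS n1 => s cs /=; rewrite (chartK cs).
apply: near_eq_is_derive E1 _; split.
  exact/derivable1_diffP/differentiable_comp.
have D' := derive_comp (1 : R) dchart df.
apply: etrans D' _; rewrite Dc.
by rewrite (derive_gradient _ df) /lie_fun /pairing (differentialE hf).
Qed.

(** This is where the connectedness of the arcs enters: the mean value theorem is applied on the
    segment between the two parameters. *)
Lemma constant_along E (I : set R) c f : is_interval I ->
  integral_curve_on E I c ->
  (forall t, I t -> smooth_fun_near (c t) f) ->
  (forall t, I t -> lie_fun E f (c t) = 0) ->
  forall s t, I s -> I t -> f (c s) = f (c t).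
Proof.
move=> iI cI sf Ef.
have H s t : I s -> I t -> s <= t -> f (c s) = f (c t).
  move=> Is It st.
  have Iz z : z \in `[s, t]%R -> I z by rewrite in_itv /=; exact: iI Is It z.
  have D z : I z -> is_derive z (1 : R) (f \o c) 0.
    move=> hz; have [c1 c2] := cI z hz.
    by rewrite -(Ef z hz); exact: is_derive_along (sf z hz).
  have Doo z (zst : z \in `]s, t[%R) := D z (Iz z (subset_itv_oo_cc zst)).
  have [|z _] := MVT_segment st Doo.
    by apply: derivable_within_continuous => z /Iz /D [].
  by rewrite mul0r => /eqP; rewrite subr_eq0 => /eqP/esym.
by move=> s t Is It; have [st|/ltW ts] := leP s t; [|symmetry]; exact: H.
Qed.

End integral_curves.

Section bracket_algebra.
Context {R : realType} {n : nat} {M : manifold R n}.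
Implicit Types (p : M) (f g h : M -> R) (L : M -> 'M[R]_n).

Lemma bracketM L f g h p : smooth_fun_near p g -> smooth_fun_near p h ->
  bracket L f (g \* h) p = g p * bracket L f h p + h p * bracket L f g p.
Proof.
move=> hg hh; rewrite /bracket (differentialM hg hh).
exact: etrans (bivecDr _ _ _ _) (congr2 +%R (bivecZr _ _ _ _) (bivecZr _ _ _ _)).
Qed.

Lemma bracketNr L f g p : smooth_fun_near p g ->
  bracket L f (fun q => - g q) p = - bracket L f g p.
Proof.
move=> hg; have -> : (fun q => - g q) = (fun=> 0) \- g.
  by apply/funext => q; rewrite /= sub0r.
rewrite /bracket (differentialB (smooth_fun_near_cst p 0) hg).
by rewrite differential_cst sub0r bivecNr.
Qed.

Lemma differential_near0 f p : (\forall q \near p, f q = 0) ->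
  differential f p = 0.
Proof.
move=> f0; rewrite -(differential_cst p 0); apply: esym.
apply: differential_near (smooth_fun_near_cst p 0).
by apply: filterS f0 => q ->.
Qed.

End bracket_algebra.

(** * Projection along the integral curves of [E] *)

Section projection.
Context {R : realType} {n : nat} {M : manifold R n.+1} {M0 : manifold R n}.
Context {L : M -> 'M[R]_n.+1} {E : M -> 'rV[R]_n.+1} {W : M -> 'M[R]_n.+1}.
Context (hM : twisted_jacobi L E W).
Context {i : M0 -> M} (hi : embedding i).
Context {U : set M} {r : M -> M0} (hU : tubular_projection i E U r).
Context {W0 : M0 -> 'M[R]_n} (hW0 : form2_field W0).
Context (hW : is_pullback_on U r W W0).
Implicit Types (p : M) (x : M0) (f g h : M0 -> R).

Let oU : open U. Proof. by case: hU. Qed.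
Let sr : smooth_map_on U r. Proof. by case: hU. Qed.
Let si : smooth_map_on setT i. Proof. by case: hi. Qed.
Let bL : bivector_field L. Proof. by case: hM. Qed.
Let vE : vector_field E. Proof. by case: hM. Qed.
Let fW : form2_field W. Proof. by case: hM. Qed.
Let skL p : (L p)^T = - L p. Proof. exact: bL.1. Qed.

(** The arc over [x] fills the part in [U] of the fiber over [x], and passes through [i x] at
    parameter [0]. So [i] is a section of [r]. *)
Lemma embedding_in_fiber x : U (i x) /\ r (i x) = x.
Proof.
case: hU => _ _ _ /(_ x) [I [c [[_ _ I0] c0 _ _ cI]]].
have : (c @` I) (c 0) by exists 0.
by rewrite cI c0.
Qed.

Let Ui x : U (i x). Proof. exact: (embedding_in_fiber x).1. Qed.
Let ri x : r (i x) = x. Proof. exact: (embedding_in_fiber x).2. Qed.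

Lemma fiber_curve p : U p -> exists (I : set R) (c : R -> M) (t : R),
  [/\ [/\ open I, is_interval I, I 0 & I t], c 0 = i (r p), c t = p,
      integral_curve_on E I c & forall s, I s -> U (c s) /\ r (c s) = r p].
Proof.
move=> Up; case: hU => _ _ _ /(_ (r p)) [I [c [[oI iI I0] c0 cE _ cI]]].
have : (U `&` r @^-1` [set r p]) p by [].
rewrite -cI => -[t It ct]; exists I, c, t; split=> // s Is.
have : (c @` I) (c s) by exists s.
by rewrite cI => -[].
Qed.

(** [f \o r] is constant on the arc through [p], and the velocity of that arc at [p] is [E p]. *)
Lemma lie_fun_pullback p f : U p -> smooth_fun_near (r p) f ->
  lie_fun E (f \o r) p = 0.
Proof.
move=> Up hf; have [I [c [t [[oI _ _ It] _ ct cE cr]]]] := fiber_curve Up.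
have hfr := smooth_fun_near_comp oU sr Up hf.
have [c1 c2] := cE t It; rewrite -ct in hfr *.
have D := is_derive_along c1 c2 hfr; rewrite -(@derive_val _ _ _ _ _ _ _ D).
have E1 : \forall s \near t, cst (f (r p)) s = ((f \o r) \o c) s.
  apply: filterS (open_nbhs_nbhs (conj oI It)) => s /cr [_ rs].
  by rewrite /= rs.
rewrite -(near_eq_derive (1 : R) E1).
exact: (@derive_cst R R^o R^o).
Qed.

Lemma differential_center x k : differential (coordinate x k) x = delta_mx k 0.
Proof.
rewrite differential_coordinate; last exact: chart_dom_center.
by rewrite transition_mx_id ?mul1mx //; exact: chart_dom_center.
Qed.

Lemma tangent_projection_coordinate p k : U p ->
  tangent_mx r p *m delta_mx k 0 =
  differential (coordinate (r p) k \o r) p.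
Proof.
move=> Up; have hc := smooth_coordinate k (chart_dom_center (r p)).
by rewrite (differential_comp oU sr Up hc) differential_center.
Qed.

Lemma E_tangent_projection p : U p -> E p *m tangent_mx r p = 0.
Proof.
move=> Up; apply/matrixP => a k; rewrite (ord1 a) [RHS]mxE.
have := lie_fun_pullback Up (smooth_coordinate k (chart_dom_center (r p))).
rewrite /lie_fun /pairing -tangent_projection_coordinate // mulmxA.
by move: (E p *m _) => v; rewrite -colE mxE.
Qed.

Lemma lie_bivector_eq0 p (F G : M -> R) : U p ->
  smooth_fun_near p F -> smooth_fun_near p G -> lie_bivector E L F G p = 0.
Proof.
move=> Up hF hG; case: hM => _ _ _ _ /(_ p F G hF hG) /= ->.
have ET := E_tangent_projection Up.
have form0 X : form2 (W p) X (E p) = 0.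
  rewrite (hW Up); apply: etrans (form2_pullback _ _ _ _) _.
  by rewrite ET /form2 trmx0 mulmx0 mxE.
have ext0 X Y : ext_d W p X Y (E p) = 0.
  apply: etrans (ext_d_pullback oU sr _ _ _ fW hW0 hW Up) _.
  (* The zero vector is written [0 *: 0] so that homogeneity in the last slot gives the
     vanishing. *)
  by rewrite ET -(scale0r 0) (ext_dZ _ _ _ _ _ hW0) mul0r.
have cancel (a b c u v : R) : a = 0 -> b = 0 -> c = 0 ->
    - a - (b * u - c * v) = 0.
  by move=> -> -> ->; rewrite !mul0r !subr0 oppr0.
by apply: cancel; [exact: ext0|exact: form0|exact: form0].
Qed.

(** The pushforward by [r], computed at the point [i x] of the fiber; [projected_bivectorE] shows
    that any other point of the fiber in [U] gives the same result. *)
Definition projected_bivector x : 'M[R]_n :=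
  (tangent_mx r (i x))^T *m L (i x) *m tangent_mx r (i x).

Local Notation L0 := projected_bivector.

(** By [[E, L] = 0], the derivative along [E] of the bracket is
    [{E(f o r), g o r} + {f o r, E(g o r)}]. Both terms vanish because [E(f o r)] and [E(g o r)] are
    zero on a whole neighbourhood, hence have zero differential. *)
Lemma bracket_pullback_fiber p f g : U p ->
  smooth_fun_near (r p) f -> smooth_fun_near (r p) g ->
  bracket L (f \o r) (g \o r) p = bracket L (f \o r) (g \o r) (i (r p)).
Proof.
move=> Up hf hg.
have [I [c [t [[oI iI I0 It] c0 ct cE cr]]]] := fiber_curve Up.
rewrite -c0 -{1}ct; apply: (constant_along iI cE) => // s Is.
  have [Us rs] := cr s Is.
  by apply: smooth_bracket => //; apply: (smooth_fun_near_comp oU sr Us);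
    rewrite rs.
have [Us rs] := cr s Is; rewrite -rs in hf hg.
have hF := smooth_fun_near_comp oU sr Us hf.
have hG := smooth_fun_near_comp oU sr Us hg.
have dE f' : smooth_fun_near (r (c s)) f' ->
    differential (lie_fun E (f' \o r)) (c s) = 0.
  move=> hf'; apply: differential_near0.
  have n1 := open_nbhs_nbhs (conj oU Us).
  have n2 := near_map sr Us (smooth_fun_near_near hf').
  by apply: filterS (filterI n1 n2) => q [Uq hq]; exact: lie_fun_pullback.
have b1 : bracket L (lie_fun E (f \o r)) (g \o r) (c s) = 0.
  by rewrite /bracket (dE f hf) bivec0l.
have b2 : bracket L (f \o r) (lie_fun E (g \o r)) (c s) = 0.
  by rewrite /bracket (dE g hg) bivec0r.
have cancel (u v w : R) : v = 0 -> w = 0 -> u - v - w = 0 -> u = 0.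
  by move=> -> ->; rewrite !subr0.
exact: cancel b1 b2 (lie_bivector_eq0 Us hF hG).
Qed.

Lemma bracket_pullback p f g : U p ->
  smooth_fun_near (r p) f -> smooth_fun_near (r p) g ->
  bracket L (f \o r) (g \o r) p = bracket L0 f g (r p).
Proof.
move=> Up hf hg; rewrite (bracket_pullback_fiber Up hf hg) /bracket.
have hf' : smooth_fun_near (r (i (r p))) f by rewrite ri.
have hg' : smooth_fun_near (r (i (r p))) g by rewrite ri.
rewrite (differential_comp oU sr (Ui _) hf') (differential_comp oU sr (Ui _) hg').
by rewrite !ri bivec_pullback.
Qed.

Lemma projected_bivectorE p : U p ->
  L0 (r p) = (tangent_mx r p)^T *m L p *m tangent_mx r p.
Proof.
move=> Up; apply/matrixP => j k.
have hc l := smooth_coordinate l (chart_dom_center (r p)).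
have e1 : L0 (r p) j k =
    bracket L0 (coordinate (r p) j) (coordinate (r p) k) (r p).
  by rewrite /bracket !differential_center; exact: esym (bivec_delta _ _ _).
have e2 : bracket L (coordinate (r p) j \o r) (coordinate (r p) k \o r) p =
    bivec (L p) (tangent_mx r p *m delta_mx j 0) (tangent_mx r p *m delta_mx k 0).
  by rewrite /bracket !tangent_projection_coordinate.
apply: etrans e1 (etrans (esym (bracket_pullback Up (hc j) (hc k))) _).
exact: etrans e2 (etrans (bivec_pullback _ _ _ _) (bivec_delta _ _ _)).
Qed.

Lemma projected_bivector_skew x : (L0 x)^T = - L0 x.
Proof.
rewrite /projected_bivector !trmx_mul trmxK skL.
by move: (tangent_mx _ _) (L _) => T B; rewrite mulNmx mulmxN mulmxA.
Qed.

Lemma bracket_projected x f g : smooth_fun_near x f -> smooth_fun_near x g ->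
  bracket L (f \o r) (g \o r) (i x) = bracket L0 f g x.
Proof.
by move=> hf hg; rewrite bracket_pullback ?ri //; exact: Ui.
Qed.

Lemma smooth_projection x f : smooth_fun_near x f ->
  smooth_fun_near (i x) (f \o r).
Proof.
by move=> hf; apply: (smooth_fun_near_comp oU sr (Ui x)); rewrite ri.
Qed.

Lemma lie_fun_projection x f : smooth_fun_near x f ->
  lie_fun E (f \o r) (i x) = 0.
Proof. by move=> hf; apply: (lie_fun_pullback (Ui x)); rewrite ri. Qed.

Lemma smooth_restriction x (F : M -> R) : smooth_fun_near (i x) F ->
  smooth_fun_near x (F \o i).
Proof. exact: (smooth_fun_near_comp openT si). Qed.

Lemma differential_restriction x (F : M -> R) : smooth_fun_near (i x) F ->
  differential (F \o i) x = tangent_mx i x *m differential F (i x).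
Proof. exact: (differential_comp openT si). Qed.

Lemma differential_projection x f : smooth_fun_near x f ->
  differential (f \o r) (i x) = tangent_mx r (i x) *m differential f x.
Proof.
by move=> hf; rewrite (differential_comp oU sr (Ui x)) ri.
Qed.

(** Near [x], the bracket on [M0] is the restriction along [i] of a smooth bracket on [M]. The
    smoothness of [L0] thus follows without differentiating [tangent_mx r] in moving charts. *)
Lemma smooth_projected_bracket x f g :
  smooth_fun_near x f -> smooth_fun_near x g ->
  smooth_fun_near x (bracket L0 f g).
Proof.
move=> hf hg.
apply: smooth_fun_near_ext (smooth_restriction (smooth_bracket bL
  (smooth_projection hf) (smooth_projection hg))).
apply: filterS (filterI (smooth_fun_near_near hf) (smooth_fun_near_near hg)).
by move=> y [hfy hgy]; exact: bracket_projected.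
Qed.

Lemma projected_bivector_field : bivector_field L0.
Proof.
apply: bivector_fieldP; first exact: projected_bivector_skew.
move=> x y j k xy.
by apply: smooth_projected_bracket; exact: smooth_coordinate.
Qed.

Lemma near_projected_bracket x f g : smooth_fun_near x f -> smooth_fun_near x g ->
  \forall p \near i x, bracket L (f \o r) (g \o r) p = (bracket L0 f g \o r) p.
Proof.
move=> hf hg; have n1 := open_nbhs_nbhs (conj oU (Ui x)).
have hf' : smooth_fun_near (r (i x)) f by rewrite ri.
have hg' : smooth_fun_near (r (i x)) g by rewrite ri.
have n2 := near_map sr (Ui x) (smooth_fun_near_near hf').
have n3 := near_map sr (Ui x) (smooth_fun_near_near hg').
apply: filterS (filterI n1 (filterI n2 n3)) => p [Up [fp gp]].
exact: bracket_pullback.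
Qed.

Lemma bracket_bracket_pullback x f g h :
  smooth_fun_near x f -> smooth_fun_near x g -> smooth_fun_near x h ->
  bracket L (f \o r) (bracket L (g \o r) (h \o r)) (i x) =
  bracket L0 f (bracket L0 g h) x.
Proof.
move=> hf hg hh; have hgh := smooth_projected_bracket hg hh.
apply: etrans _ (bracket_projected hf hgh).
apply: (congr1 (bivec _ _)).
apply: (differential_near (near_projected_bracket hg hh)).
exact: smooth_bracket bL (smooth_projection hg) (smooth_projection hh).
Qed.

Lemma sharp_projected x (a : 'cV[R]_n) :
  sharp (L (i x)) (tangent_mx r (i x) *m a) *m tangent_mx r (i x) =
  sharp (L0 x) a.
Proof. by rewrite /sharp /projected_bivector trmx_mul !mulmxA. Qed.

Lemma sharp_differential_projection x f : smooth_fun_near x f ->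
  sharp (L (i x)) (differential (f \o r) (i x)) *m tangent_mx r (i x) =
  sharp (L0 x) (differential f x).
Proof. by move=> /differential_projection ->; exact: sharp_projected. Qed.

Lemma projected_twisted_poisson : exact_twisted_poisson L0 W0.
Proof.
split=> //; first exact: projected_bivector_field.
move=> x f g h hf hg hh.
have [hF hG hH] := And3 (smooth_projection hf) (smooth_projection hg)
  (smooth_projection hh).
(* Each term of the two wedge products with [E] carries the derivative along [E] of a function
   pulled back by [r]; these are [u], [v] and [w]. *)
have cancel (s t u v w a b c a' b' c' : R) : u = 0 -> v = 0 -> w = 0 ->
    s + (u * a + v * b + w * c) = t + (u * a' + v * b' + w * c') -> s = t.
  by move=> -> -> ->; rewrite !mul0r !addr0.
case: hM => _ _ _ /(_ (i x) _ _ _ hF hG hH) hS _.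
have {}hS := cancel _ _ _ _ _ _ _ _ _ _ _ (lie_fun_projection hf)
  (lie_fun_projection hg) (lie_fun_projection hh) hS.
apply: etrans (esym _) (etrans hS _).
  exact: (congr2 +%R (congr2 +%R (bracket_bracket_pullback hf hg hh)
    (bracket_bracket_pullback hg hh hf)) (bracket_bracket_pullback hh hf hg)).
apply: (congr1 -%R).
apply: etrans (ext_d_pullback oU sr _ _ _ fW hW0 hW (Ui x)) _.
rewrite ri; exact: (f_equal3 (ext_d W0 x) (sharp_differential_projection hf)
  (sharp_differential_projection hg) (sharp_differential_projection hh)).
Qed.

Lemma projection_twisted_jacobi_map :
  twisted_jacobi_map_on U r L E W L0 (fun=> 0) W0.
Proof.
split; [exact: sr|exact: projected_bivectorE| |exact: hW].
by move=> p Up; exact: esym (E_tangent_projection Up).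
Qed.

(** * The field [Z0] and the splitting of tensors along the hypersurface *)

Context {eta : M0 -> 'cV[R]_n.+1} (heta : conormal_form i E eta).

(** [L^#(eta)] consists of vectors tangent to [M]. Its image under the tangent map of [r] has
    components in [M0], and loses nothing by [characteristic_field_tangent]. *)
Definition characteristic_field x : 'rV[R]_n :=
  sharp (L (i x)) (eta x) *m tangent_mx r (i x).

Local Notation Z0 := characteristic_field.

Lemma tangent_section x : tangent_mx i x *m tangent_mx r (i x) = 1%:M.
Proof.
apply/matrixP => j k; have hc := smooth_coordinate k (chart_dom_center x).
have Ej : tangent_mx i x *m tangent_mx r (i x) *m (delta_mx k 0 : 'cV_n) =
    delta_mx k 0.
  have := differential_restriction (smooth_projection hc).
  rewrite (differential_projection hc) (differential_center x k) mulmxA => <-.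
  rewrite -(differential_center x k); congr (differential _ _).
  by apply/funext => y /=; rewrite ri.
move: Ej; move: (tangent_mx i x *m tangent_mx r (i x)) => B.
by rewrite -colE => /colP/(_ j); rewrite !mxE eqxx andbT.
Qed.

(** The two summands are the projections attached to the splitting of the tangent space at [i x]
    into the tangent space of the hypersurface and the line of [E]. *)
Lemma tangent_decomposition x :
  tangent_mx r (i x) *m tangent_mx i x + eta x *m E (i x) = 1%:M.
Proof.
have [eE ei] := heta x; have e1 := tangent_section x.
have e2 := E_tangent_projection (Ui x).
have e3 : E (i x) *m eta x = 1%:M.
  by apply/matrixP => a b; rewrite !ord1 [LHS]eE mxE.
have e4 : tangent_mx i x *m eta x = 0.
  apply/colP => j; rewrite mxE; have := ei (delta_mx 0 j).
  by rewrite /pairing -mulmxA -rowE !mxE.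
move: e1 e2 e3 e4.
move: (tangent_mx i x) (tangent_mx r (i x)) (E (i x)) (eta x) => S T e h.
move=> e1 e2 e3 e4.
(* [(E; Ti)] and [(eta, Tr)] are square, so one product determines the other. *)
have BC : col_mx e S *m row_mx h T = 1%:M.
  by rewrite mul_col_row e1 e2 e3 e4 -scalar_mx_block.
by have := mulmx1C BC; rewrite mul_row_col addrC.
Qed.

(** The component of [L^#(eta)] along [E] is [L(eta, eta)], which is zero by skewness. *)
Lemma characteristic_field_tangent x :
  Z0 x *m tangent_mx i x = sharp (L (i x)) (eta x).
Proof.
have D := bivec_diag (eta x) (skL (i x)); have T := tangent_decomposition x.
rewrite /characteristic_field /sharp; move: D T; rewrite /bivec.
move: (tangent_mx i x) (tangent_mx r (i x)) (E (i x)) (eta x) (L (i x)).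
move=> S T e h B D TS.
have -> : h^T *m B *m T *m S = h^T *m B *m (1%:M - h *m e).
  by rewrite -TS addrK !mulmxA.
rewrite mulmxBr mulmx1 mulmxA [h^T *m B *m h]mx11_scalar D.
by rewrite -scalemx1 scale0r mul0mx subr0.
Qed.

(** The dual splitting, on covectors: a part pulled back from [M0] and a multiple of [eta]. *)
Lemma differential_decomposition x (F : M -> R) : smooth_fun_near (i x) F ->
  differential F (i x) = tangent_mx r (i x) *m differential (F \o i) x +
    lie_fun E F (i x) *: eta x.
Proof.
move=> hF; rewrite (differential_restriction hF) /lie_fun /pairing.
have := tangent_decomposition x.
move: (tangent_mx i x) (tangent_mx r (i x)) (E (i x)) (eta x) (differential F _).
move=> S T e h d TS; rewrite mulmxA -mul_mx_scalar -mx11_scalar mulmxA -mulmxDl.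
by rewrite TS mul1mx.
Qed.

Lemma lie_fun_characteristic x f :
  lie_fun Z0 f x =
  bivec (L (i x)) (eta x) (tangent_mx r (i x) *m differential f x).
Proof. by rewrite /lie_fun /pairing /characteristic_field /bivec mulmxA. Qed.

(** Only [dF] is split: its part along [eta] contributes [L(d(f o r), eta)], which is [- Z0(f)] by
    skewness. *)
Lemma bracket_restriction x f (F : M -> R) :
  smooth_fun_near x f -> smooth_fun_near (i x) F ->
  bracket L (f \o r) F (i x) =
  bracket L0 f (F \o i) x - lie_fun Z0 f x * lie_fun E F (i x).
Proof.
move=> hf hF; rewrite lie_fun_characteristic /bracket.
rewrite (differential_decomposition hF) (differential_projection hf).
rewrite bivecDr bivecZr bivec_pullback (bivecC _ (eta x) (skL (i x))).
by rewrite mulrN mulrC.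
Qed.

(** Here [ds] has no part pulled back from [M0], so it equals [(E s) eta]. *)
Lemma bracket_defining_function x (s F : M -> R) :
  smooth_fun_near (i x) s -> smooth_fun_near (i x) F ->
  differential (s \o i) x = 0 ->
  bracket L s F (i x) = lie_fun E s (i x) * lie_fun Z0 (F \o i) x.
Proof.
move=> hs hF s0; rewrite lie_fun_characteristic /bracket.
rewrite (differential_decomposition hs) s0 mulmx0 add0r.
rewrite (differential_decomposition hF).
exact: bivec_line (skL (i x)).
Qed.

(** Since [eta(E) = 1], [E] is nonzero at [i x], so some coordinate has a nonzero derivative along
    it. Subtracting a function pulled back by [r] leaves this derivative unchanged. *)
Lemma exists_defining_function x : exists s : M -> R,
  [/\ smooth_fun_near (i x) s, forall y, s (i y) = 0 & lie_fun E s (i x) != 0].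
Proof.
have [k Ek] : exists k, E (i x) 0 k != 0.
  apply/existsP; rewrite -negb_forall; apply/negP => /forallP E0.
  have [+ _] := heta x; have -> : E (i x) = 0.
    by apply/rowP => k; rewrite mxE; exact/eqP.
  by rewrite /pairing mul0mx mxE => /esym/eqP; rewrite oner_eq0.
pose q := coordinate (i x) k.
have hq : smooth_fun_near (i x) q := smooth_coordinate k (chart_dom_center (i x)).
have hqi := smooth_restriction hq; have hqir := smooth_projection hqi.
exists (q \- ((q \o i) \o r)); split.
- exact: smooth_fun_nearB.
- by move=> y /=; rewrite ri subrr.
have -> : lie_fun E (q \- ((q \o i) \o r)) (i x) =
    lie_fun E q (i x) - lie_fun E ((q \o i) \o r) (i x).
  rewrite /lie_fun /pairing (differentialB hq hqir) mulmxBr.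
  by rewrite mxE [X in _ + X]mxE.
have -> : lie_fun E ((q \o i) \o r) (i x) = 0.
  by apply: (lie_fun_pullback (Ui x)); rewrite ri.
rewrite subr0 /lie_fun /pairing /q.
rewrite differential_coordinate; last exact: chart_dom_center.
rewrite transition_mx_id ?mul1mx; last exact: chart_dom_center.
by move: Ek; move: (E (i x)) => e; rewrite -colE mxE.
Qed.

Lemma projection_restrictionK f : (f \o r) \o i = f.
Proof. by apply/funext => y /=; rewrite ri. Qed.

(** As [s] vanishes on the entire hypersurface, the formula holds at all nearby points of [M0] and
    may be differentiated along [M0]. *)
Lemma near_bracket_defining_function x (s : M -> R) f :
  smooth_fun_near (i x) s -> (forall y, s (i y) = 0) -> smooth_fun_near x f ->
  \forall y \near x, bracket L s (f \o r) (i y) =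
    lie_fun E s (i y) * lie_fun Z0 f y.
Proof.
move=> hs s0 hf; have n1 := near_map si I (smooth_fun_near_near hs).
apply: filterS (filterI n1 (smooth_fun_near_near hf)) => y [hsy hfy].
have ds : differential (s \o i) y = 0.
  by apply: differential_near0; near=> z; exact: s0.
apply: etrans (bracket_defining_function hsy (smooth_projection hfy) ds) _.
by rewrite projection_restrictionK.
Unshelve. all: by end_near. Qed.

(** [conormal_form] says nothing about how [eta] varies; smoothness comes from the expression
    [{s, f o r} / E s] of [Z0(f)] near [x]. *)
Lemma smooth_lie_characteristic x f : smooth_fun_near x f ->
  smooth_fun_near x (lie_fun Z0 f).
Proof.
move=> hf; have [s [hs s0 us]] := exists_defining_function x.
have hu := smooth_restriction (smooth_lie_fun vE hs).
have hb := smooth_restriction (smooth_bracket bL hs (smooth_projection hf)).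
have hv : smooth_fun_near x (fun y => (lie_fun E s (i y))^-1).
  exact: (@smooth_fun_nearV _ _ _ x (lie_fun E s \o i) us hu).
apply: smooth_fun_near_ext (smooth_fun_nearM hv hb).
have n1 : \forall y \near x, lie_fun E s (i y) != 0.
  exact: (@smooth_fun_near_neq0 _ _ _ x (lie_fun E s \o i) us hu).
have n2 := near_bracket_defining_function hs s0 hf.
apply: filterS (filterI n1 n2) => y [uy Ey].
apply: etrans (congr1 (fun v => (lie_fun E s (i y))^-1 * v) Ey) _.
exact: mulKf.
Qed.

Lemma characteristic_vector_field : vector_field Z0.
Proof.
apply: vector_fieldP => x y k xy.
exact/smooth_lie_characteristic/smooth_coordinate.
Qed.

(** * The Lie derivative of the projected bivector along [Z0] *)

Lemma bracket_lie_pullback0 x (F : M -> R) f : smooth_fun_near x f ->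
  bracket L F (lie_fun E (f \o r)) (i x) = 0.
Proof.
move=> hf; have d0 : differential (lie_fun E (f \o r)) (i x) = 0.
  apply: differential_near0; have n1 := open_nbhs_nbhs (conj oU (Ui x)).
  have n2 : \forall p \near i x, smooth_fun_near (r p) f.
    have hf' : smooth_fun_near (r (i x)) f by rewrite ri.
    have := near_map sr (Ui x) (smooth_fun_near_near hf'); exact.
  by apply: filterS (filterI n1 n2) => p [Up hp]; exact: lie_fun_pullback.
by rewrite /bracket d0 bivec0r.
Qed.

(** By [bracket_restriction], the outer bracket needs the restriction [(E s) Z0(f)] of the inner one
    and its derivative along [E]. The result is arranged so that all terms but the first are visibly
    symmetric in [f] and [g]. *)
Lemma bracket_bracket_defining_function x (s : M -> R) f g :
  smooth_fun_near (i x) s -> (forall y, s (i y) = 0) ->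
  smooth_fun_near x f -> smooth_fun_near x g ->
  bracket L (g \o r) (bracket L s (f \o r)) (i x) =
  lie_fun E s (i x) * bracket L0 g (lie_fun Z0 f) x +
  (lie_fun Z0 f x * bracket L0 g (lie_fun E s \o i) x +
   lie_fun Z0 g x * bracket L0 f (lie_fun E s \o i) x) -
  lie_fun Z0 g x * lie_fun Z0 f x * lie_fun E (lie_fun E s) (i x).
Proof.
move=> hs s0 hf hg; have hF := smooth_projection hf.
have hb := smooth_bracket bL hs hF; have hu := smooth_lie_fun vE hs.
have hui := smooth_restriction hu; have hZ := smooth_lie_characteristic hf.
have A1 : bracket L0 g (bracket L s (f \o r) \o i) x =
    bracket L0 g ((lie_fun E s \o i) \* lie_fun Z0 f) x.
  apply: (congr1 (bivec _ _)).
  exact: differential_near (near_bracket_defining_function hs s0 hf)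
    (smooth_restriction hb).
have A2 := bracketM L0 g hui hZ.
(* The only derivative off the hypersurface: [[E, L] = 0] replaces [E{s, f o r}] by [{E s, f o r}],
   to which [bracket_restriction] applies once more. *)
have A3 : lie_fun E (bracket L s (f \o r)) (i x) =
    - (bracket L0 f (lie_fun E s \o i) x
       - lie_fun Z0 f x * lie_fun E (lie_fun E s) (i x)).
  apply: etrans (congr1 -%R (bracket_restriction hf hu)).
  apply: etrans (bracketC _ _ (skL (i x))).
  have cancel (a b c : R) : a - b - c = 0 -> c = 0 -> a = b.
    by move=> + c0; rewrite c0 subr0 => /eqP; rewrite subr_eq0 => /eqP.
  exact: cancel (lie_bivector_eq0 (Ui x) hs hF) (bracket_lie_pullback0 _ hf).
have combine (a b c d e k l m : R) : a = b - c * d ->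
    b = k * l + m * e -> forall o q, d = - (o - m * q) ->
    a = k * l + (m * e + c * o) - c * m * q.
  by move=> -> -> o q ->; ring.
exact: combine (bracket_restriction hg hb) (etrans A1 A2) _ _ A3.
Qed.

(** Writing [{g o r, s}] as [- {s, g o r}] gives the two nested brackets with inner [s] opposite
    signs, so their symmetric terms cancel. What remains is [E s] times the three terms of the Lie
    derivative. *)
Lemma half_schouten_defining_function x (s : M -> R) f g :
  smooth_fun_near (i x) s -> (forall y, s (i y) = 0) ->
  smooth_fun_near x f -> smooth_fun_near x g ->
  half_schouten L (f \o r) (g \o r) s (i x) =
  lie_fun E s (i x) * lie_bivector Z0 L0 f g x.
Proof.
move=> hs s0 hf hg.
have hF := smooth_projection hf; have hG := smooth_projection hg.
have K1 := bracket_bracket_defining_function hs s0 hf hg.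
have K2 : bracket L (f \o r) (bracket L (g \o r) s) (i x) =
    - bracket L (f \o r) (bracket L s (g \o r)) (i x).
  apply: etrans _ (bracketNr _ _ (smooth_bracket bL hs hG)).
  apply: (congr1 (fun F => bracket L _ F (i x))); apply/funext => p.
  exact: bracketC (skL p).
have K2' := bracket_bracket_defining_function hs s0 hg hf.
have K3 : bracket L s (bracket L (f \o r) (g \o r)) (i x) =
    lie_fun E s (i x) * lie_fun Z0 (bracket L0 f g) x.
  have ds : differential (s \o i) x = 0.
    by apply: differential_near0; apply: nearW.
  apply: etrans (bracket_defining_function hs (smooth_bracket bL hF hG) ds) _.
  have hb := smooth_restriction (smooth_bracket bL hF hG).
  have nb : \forall y \near x,
      (bracket L (f \o r) (g \o r) \o i) y = bracket L0 f g y.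
    apply: filterS (filterI (smooth_fun_near_near hf) (smooth_fun_near_near hg)).
    by move=> y [hfy hgy]; exact: bracket_projected.
  apply: (congr1 (fun d => _ * pairing d (Z0 x))); exact: differential_near nb hb.
have K5 := bracketC (lie_fun Z0 f) g (projected_bivector_skew x).
have combine (a b c k fu gu q zf zg Z fzg gzf zfg : R) :
    a = - b -> b = k * fzg + (zg * fu + zf * gu) - zf * zg * q ->
    c = k * gzf + (zf * gu + zg * fu) - zg * zf * q ->
    zfg = - gzf -> 
    a + c + k * Z = k * (Z - zfg - fzg).
  by move=> -> -> -> ->; ring.
apply: etrans (congr2 (fun v w => bracket L (f \o r) (bracket L (g \o r) s) (i x)
  + v + w) erefl K3) _.
exact: combine K2 K2' K1 K5.
Qed.

(** The factor [E s] has three sources: [half_schouten_defining_function]; the wedge products with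
    [E], where only the term with [E s] survives; and [dW], because [L^#(ds)] projects to
    [(E s) Z0]. *)
Lemma projected_lie_bivector x f g : smooth_fun_near x f -> smooth_fun_near x g ->
  lie_bivector Z0 L0 f g x =
  - bracket L0 f g x -
  sharp2 (L0 x) (fun X Y => ext_d W0 x (Z0 x) X Y - form2 (W0 x) X Y)
    (differential f x) (differential g x).
Proof.
move=> hf hg; have [s [hs s0 us]] := exists_defining_function x.
have hF := smooth_projection hf; have hG := smooth_projection hg.
have ds : differential (s \o i) x = 0.
  by apply: differential_near0; apply: nearW.
have sf := sharp_differential_projection hf.
have sg := sharp_differential_projection hg.
have ss : sharp (L (i x)) (differential s (i x)) *m tangent_mx r (i x) =
    lie_fun E s (i x) *: Z0 x.
  rewrite (differential_decomposition hs) ds mulmx0 add0r.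
  rewrite /sharp /characteristic_field /sharp.
  move: (lie_fun E s (i x)) (eta x) (L (i x)) (tangent_mx r (i x)) => c a B T.
  by rewrite linearZ -!scalemxAl.
have K1 := half_schouten_defining_function hs s0 hf hg.
have K2 : ext_d W (i x) (sharp (L (i x)) (differential (f \o r) (i x)))
    (sharp (L (i x)) (differential (g \o r) (i x)))
    (sharp (L (i x)) (differential s (i x))) =
    lie_fun E s (i x) * ext_d W0 x (Z0 x) (sharp (L0 x) (differential f x))
      (sharp (L0 x) (differential g x)).
  apply: etrans (ext_d_pullback oU sr _ _ _ fW hW0 hW (Ui x)) _; rewrite ri.
  apply: etrans (f_equal3 (ext_d W0 x) sf sg ss) _.
  apply: etrans (ext_dZ _ _ _ _ _ hW0) _; apply: (congr1 ( *%R _)).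
  (* A cyclic permutation of the three terms of [ext_d] moves [Z0] from the last slot to the
     first. *)
  have cyc (a b c : R) : a + b + c = c + a + b by rewrite -[RHS]addrA [RHS]addrC.
  exact: cyc.
have K3 : form2 (W (i x)) (sharp (L (i x)) (differential (f \o r) (i x)))
    (sharp (L (i x)) (differential (g \o r) (i x))) =
    form2 (W0 x) (sharp (L0 x) (differential f x))
      (sharp (L0 x) (differential g x)).
  rewrite (hW (Ui x)); apply: etrans (form2_pullback _ _ _ _) _; rewrite ri.
  exact: (congr2 (form2 (W0 x)) sf sg).
have K4 := bracket_projected hf hg.
case: hM => _ _ _ /(_ (i x) _ _ _ hF hG hs) hS _.
(* [k] is [E s], nonzero by the choice of [s]; [b] and [c] are the derivatives along [E] of [f \o r]
   and [g \o r]. *)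
have combine (a b c d e k l m b1 b2 b3 b4 o p q : R) :
    a + (b * b1 + c * b2 + k * d) = - e + (b * b3 + c * b4 + k * l) ->
    b = 0 -> c = 0 -> a = k * m -> e = k * o -> l = p -> d = q -> k != 0 ->
    m = - q - (o - p).
  move=> + b0 c0 a0 e0 l0 d0 k0; rewrite a0 b0 c0 e0 l0 d0 !mul0r !add0r => h.
  by apply: (mulfI k0); rewrite -[LHS](addrK (k * q)) h; ring.
exact: combine hS (lie_fun_projection hf) (lie_fun_projection hg) K1 K2 K3 K4 us.
Qed.

End projection.

Theorem proposition2p5 (R : realType) (n : nat)
    (M : manifold R n.+1) (L : M -> 'M[R]_n.+1) (E : M -> 'rV[R]_n.+1)
    (W : M -> 'M[R]_n.+1) (hM : twisted_jacobi L E W)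
    (M0 : manifold R n) (i : M0 -> M) (hi : embedding i)
    (hE : transverse i E)
    (U : set M) (r : M -> M0) (hU : tubular_projection i E U r)
    (eta : M0 -> 'cV[R]_n.+1) (heta : conormal_form i E eta)
    (W0 : M0 -> 'M[R]_n) (hW0 : form2_field W0)
    (hW : is_pullback_on U r W W0) :
  exists Z0 : M0 -> 'rV[R]_n,
    [/\ vector_field Z0,
        forall x, Z0 x *m tangent_mx i x = sharp (L (i x)) (eta x)
      & exists L0 : M0 -> 'M[R]_n,
          unique (fun L' : M0 -> 'M[R]_n =>
            [/\ exact_twisted_poisson L' W0,
                twisted_jacobi_map_on U r L E W L' (fun=> 0) W0
              & forall (x : M0) (f g : M0 -> R),
                  smooth_fun_near x f -> smooth_fun_near x g ->
                  let a := differential f x in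
                  let b := differential g x in
                  lie_bivector Z0 L' f g x =
                  - bracket L' f g x -
                  sharp2 (L' x)
                    (fun X Y => ext_d W0 x (Z0 x) X Y - form2 (W0 x) X Y) a b])
            L0 /\
          (homogeneous L0 W0 Z0 <-> is_contraction_d W0 Z0)].
Proof.
pose Z0 := @characteristic_field R n M M0 L i r eta.
pose L0 := @projected_bivector R n M M0 L i r.
have lieL0 := projected_lie_bivector hM hi hU hW0 hW heta.
exists Z0; split.
- exact (characteristic_vector_field hM hi hU heta).
- exact (characteristic_field_tangent hM hi hU heta).
exists L0; split; [split|split].
- split; [exact (projected_twisted_poisson hM hi hU hW0 hW)| |exact lieL0].
  exact (projection_twisted_jacobi_map hM hU hW0 hW).
(* The pushforward condition at the single point [i x] already determines [L' x]. *)
- move=> L' [_ [_ hL' _ _] _]; apply/funext => x.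
  have [Ux rx] := embedding_in_fiber hU x.
  by have := hL' _ Ux; rewrite rx => ->.
- by case.
(* The correction term is the difference of the two sides of [hC], evaluated on the images of the
   differentials under [L0^#]. *)
- move=> hC; split=> // x f g hf hg; apply: etrans (lieL0 x f g hf hg) _.
  have cancel (a b c : R) : b = c -> a - (c - b) = a.
    by move=> ->; rewrite subrr subr0.
  exact: cancel (hC x _ _).
Qed.
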